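(* Let $P\in\mathbb Z$ with $3\nmid P$ or $27\mid P$, and let $D,Q\in\mathbb Z$ be such that $D$ is not a perfect square and $Q=P^2+27D=2^{q_1}q_0^3$ with $q_1\in\{0,1,2\}$ and $q_0\in\mathbb Z$. Suppose that $p$ is a prime of the form $3k+1$, $p\nmid Q$ and $\big(\frac{P^2-Q}p\big)=1$. Then $Q(P+\sqrt{P^2-Q})$ is a cubic residue $\pmod p$ if and only if $p$ is represented by some class in $$G(P,D)=\Big\{[a,2b,c]\in H(4D)\ \Big|\ (a,3DQ)=1,\ \Big(\frac{P-3b(1+2\omega)}a\Big)_3=1\Big\},$$ where $a>0$ when $D<0$.
   Context: $(\frac{\cdot}{p})$ is the Legendre symbol and $(m,n)$ for integers $m,n$ denotes the greatest common divisor. Modulo $p$, $\sqrt{P^2-Q}$ denotes an integer $t$ with $t^2\equiv P^2-Q\pmod p$ (the property considered does not depend on the choice of $t$); an integer $n$ is a cubic residue $\pmod p$ if $n\equiv x^3\pmod p$ for some integer $x$. Binary quadratic forms. For integers $A,B,C$, $(A,B,C)$ denotes the form $Ax^2+Bxy+Cy^2$, of discriminant $B^2-4AC$; it is primitive if $\gcd(A,B,C)=1$. Two forms are equivalent if they are related by a substitution in $SL_2(\mathbb Z)$, and $[A,B,C]$ is the equivalence class of $(A,B,C)$. For a nonsquare integer $\Delta\equiv0,1\pmod4$, $H(\Delta)$ is the form class group (under Gauss composition) of classes of primitive integral binary quadratic forms of discriminant $\Delta$ (positive definite forms if $\Delta<0$). A positive integer $n$ is represented by a class if $n=Ax^2+Bxy+Cy^2$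 for some $x,y\in\mathbb Z$, for one (equivalently every) form $(A,B,C)$ in the class. Every class of $H(4D)$ contains a form $(a,2b,c)$ with $b^2-ac=D$ and $a$ prime to any given positive integer; a class belongs to the set $G$ if it contains a form $(a,2b,c)$ satisfying the stated conditions. Cubic Jacobi symbol. Let $\omega=(-1+\sqrt{-3})/2$ and $N(a+b\omega)=a^2-ab+b^2$. An element $a+b\omega\in\mathbb Z[\omega]$ is primary if $a\equiv2\pmod3$ and $3\mid b$. For a primary prime $\pi\in\mathbb Z[\omega]$ and $\alpha\in\mathbb Z[\omega]$, $\big(\frac{\alpha}{\pi}\big)_3=0$ if $\pi\mid\alpha$, and otherwise $\big(\frac{\alpha}{\pi}\big)_3=\omega^i$ where $\alpha^{(N(\pi)-1)/3}\equiv\omega^i\pmod\pi$. If $\beta=a+b\omega$ with $3\nmid a$, $3\mid b$ and $N(\beta)>1$, write $\beta=\pm\pi_1\cdots\pi_r$ with primary primes $\pi_j$ and put $\big(\frac{\alpha}{\beta}\big)_3=\prod_j\big(\frac{\alpha}{\pi_j}\big)_3$; also $\big(\frac{\alpha}{\pm1}\big)_3=1$. *)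

(* Defs.v *)
From HB Require Import structures.
From mathcomp Require Import all_boot all_order all_algebra.
From mathcomp Require Import boolp classical_sets.
From mathcomp Require Import ring.

Set Implicit Arguments.
Unset Strict Implicit.
Unset Printing Implicit Defensive.

Import Order.TTheory GRing.Theory Num.Theory.

Local Open Scope ring_scope.

(* [Eisenstein a b] is a + b * omega, where omega ^+ 2 + omega + 1 = 0. *)
Record eisenstein := Eisenstein { ere : int; eom : int }.

Definition eis_pair (z : eisenstein) : int * int := (ere z, eom z).
Definition pair_eis (u : int * int) : eisenstein := Eisenstein u.1 u.2.
Lemma eis_pairK : cancel eis_pair pair_eis. Proof. by case. Qed.

HB.instance Definition _ := Equality.copy eisenstein (can_type eis_pairK).
HB.instance Definition _ := Choice.copy eisenstein (can_type eis_pairK).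

Definition eis_add (z w : eisenstein) : eisenstein :=
  Eisenstein (ere z + ere w) (eom z + eom w).
Definition eis_opp (z : eisenstein) : eisenstein :=
  Eisenstein (- ere z) (- eom z).
Definition eis_mul (z w : eisenstein) : eisenstein :=
  Eisenstein (ere z * ere w - eom z * eom w)
             (ere z * eom w + eom z * ere w - eom z * eom w).

Fact eis_addA : associative eis_add.
Proof. by move=> [a b] [c d] [e f]; rewrite /eis_add /= !addrA. Qed.
Fact eis_addC : commutative eis_add.
Proof. by move=> [a b] [c d]; congr Eisenstein; rewrite /= addrC. Qed.
Fact eis_add0 : left_id (Eisenstein 0 0) eis_add.
Proof. by move=> [a b]; rewrite /eis_add /= !add0r. Qed.
Fact eis_addN : left_inverse (Eisenstein 0 0) eis_opp eis_add.
Proof. by move=> [a b]; rewrite /eis_add /= !addNr. Qed.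

HB.instance Definition _ :=
  GRing.isZmodule.Build eisenstein eis_addA eis_addC eis_add0 eis_addN.

Fact eis_mulA : associative eis_mul.
Proof. by move=> [a b] [c d] [e f]; congr Eisenstein => /=; ring. Qed.
Fact eis_mulC : commutative eis_mul.
Proof. by move=> [a b] [c d]; congr Eisenstein => /=; ring. Qed.
Fact eis_mul1 : left_id (Eisenstein 1 0) eis_mul.
Proof. by move=> [a b]; congr Eisenstein => /=; ring. Qed.
Fact eis_mulD : left_distributive eis_mul +%R.
Proof. by move=> [a b] [c d] [e f]; congr Eisenstein => /=; ring. Qed.
Fact eis_1neq0 : Eisenstein 1 0 != 0.
Proof. by []. Qed.

HB.instance Definition _ := GRing.Zmodule_isComNzRing.Build eisenstein
  eis_mulA eis_mulC eis_mul1 eis_mulD eis_1neq0.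

Definition omega : eisenstein := Eisenstein 0 1.

Definition eis_norm (z : eisenstein) : int :=
  ere z ^+ 2 - ere z * eom z + eom z ^+ 2.

Definition eis_dvd (z w : eisenstein) : Prop := exists u, w = u * z.

Definition eis_prime (z : eisenstein) : Prop :=
  [/\ z != 0, ~ eis_dvd z 1 &
      forall u v, eis_dvd z (u * v) -> eis_dvd z u \/ eis_dvd z v].

Definition eis_primary (z : eisenstein) : Prop :=
  (ere z = 2 %[mod 3])%Z /\ (3 %| eom z)%Z.

Definition cubic_symbol (alpha pi : eisenstein) : eisenstein :=
  if `[< eis_dvd pi alpha >] then 0
  else if [pick i : 'I_3 | `[< eis_dvd pi
         (alpha ^+ ((`|eis_norm pi|%N).-1 %/ 3) - omega ^+ i) >]] is Some i
  then omega ^+ i else 0.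

Definition primary_factorization (beta : eisenstein) (s : seq eisenstein) :=
  (forall pi, pi \in s -> eis_prime pi /\ eis_primary pi) /\
  (beta = \prod_(pi <- s) pi \/ beta = - \prod_(pi <- s) pi).

(* The factors are unique up to order, so the factorization chosen by [xget] is
   irrelevant; for beta = 1 or -1 it is empty and the symbol is 1.  The value is
   only meaningful for beta = a + b * omega with a prime to 3 and b divisible
   by 3. *)
Definition cubic_jacobi (alpha beta : eisenstein) : eisenstein :=
  \prod_(pi <- xget [::] [set s | primary_factorization beta s])
     cubic_symbol alpha pi.

Definition cubic_residue (n : int) (p : nat) : Prop :=
  exists x : int, (n = x ^+ 3 %[mod p])%Z.

Definition legendre (n : int) (p : nat) : int :=
  if (p %| n)%Z then 0
  else if `[< exists x : int, (x ^+ 2 = n %[mod p])%Z >] then 1 else -1.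

(* [BQF A B C] is the form A x^2 + B x y + C y^2. *)
Record bqf := BQF { bqfA : int; bqfB : int; bqfC : int }.

Definition bqf_eval (f : bqf) (x y : int) : int :=
  bqfA f * x ^+ 2 + bqfB f * x * y + bqfC f * y ^+ 2.

Definition bqf_disc (f : bqf) : int := bqfB f ^+ 2 - 4 * bqfA f * bqfC f.

Definition bqf_primitive (f : bqf) : Prop :=
  gcdz (gcdz (bqfA f) (bqfB f)) (bqfC f) = 1.

Definition bqf_posdef (f : bqf) : Prop :=
  forall x y : int, (x, y) != (0, 0) -> 0 < bqf_eval f x y.

Definition bqf_equiv (f g : bqf) : Prop :=
  exists p q r s : int, p * s - q * r = 1 /\
    forall x y : int,
      bqf_eval g x y = bqf_eval f (p * x + q * y) (r * x + s * y).

Definition bqf_class (f : bqf) : set bqf := [set g | bqf_equiv f g]%classic.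

(* The underlying set of the form class group of discriminant Delta. *)
Definition form_classes (Delta : int) : set (set bqf) :=
  [set K | exists f : bqf,
     [/\ K = bqf_class f, bqf_primitive f, bqf_disc f = Delta &
         Delta < 0 -> bqf_posdef f]]%classic.

Definition class_represents (K : set bqf) (n : int) : Prop :=
  exists2 f : bqf, K f & exists x y : int, n = bqf_eval f x y.

Definition classesG (P D : int) : set (set bqf) :=
  let Q := P ^+ 2 + 27 * D in
  [set K | form_classes (4 * D) K /\
     exists a b c : int,
       [/\ K = bqf_class (BQF a (2 * b) c),
           gcdz a (3 * D * Q) = 1,
           cubic_jacobi (P%:~R - (3 * b)%:~R * (1 + 2 * omega)) a%:~R = 1 &
           D < 0 -> 0 < a]]%classic.

(* Main.v *)
Require Import Defs.
From mathcomp Require Import all_boot all_order all_algebra.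
From mathcomp Require Import classical_sets.
From mathcomp Require Import all_field cyclic.
From mathcomp Require Import boolp ring lra zify.
From HB Require Import structures.

(** Write [theta] for [1 + 2 * omega], a square root of -3, and let
    f = (a, 2b, c) be a form with b^2 - ac = D. For vectors v and z put
    r = det(v, z), let u be the value at (v, z) of the bilinear form attached
    to f, and consider gamma = r P - 3 u theta. Since
    f(v) f(z) = u^2 - D r^2, the norm r^2 P^2 + 27 u^2 of gamma is
    r^2 Q + 27 f(v) f(z).

    Modulo f(v), changing z multiplies gamma by a rational number. As a
    rational integer has trivial cubic symbol over a rational integer prime to
    it, the symbol of gamma over f(v) depends only on v
    ([trivial_symbol_all]). For v = (1, 0) it is the symbol that defines G. For
    f(v) = p it is 1 if and only if Q (P + t) is a cubic residue: if p is the
    norm of pi, then the symbol over p is that of gamma times the square of its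
    conjugate over pi, and modulo pi this product is r^3 Q (P + t) or
    r^3 Q (P - t) ([cubic_jacobi_gam_residue]). This settles the implication
    from left to right with the form (p, 2b, c), where b^2 = D modulo p.

    For the converse, the symbols at v and at another vector w must agree when
    f(v) and f(w) are prime to 3Q and to each other, which means that gamma,
    formed with v and w, has symbol 1 over n = f(v) f(w). If 3 does not divide
    r P, reciprocity turns this into the symbol of n over gamma. There 27 n is
    congruent to - r^2 Q, and Q = 2^q1 q0^3, so that only the symbols of r and
    of 2 over gamma remain. A second use of reciprocity makes them symbols over
    r and over 2, where gamma is a rational multiple of a power of theta
    ([cubic_jacobi_norm_eq1], [cubic_jacobi_gam_eq1]). If 27 divides P, the same
    argument applies to gamma / theta^3 provided 3 does not divide u.

    The conditions at 3, and the coprimality of the two values, are obtained by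
    passing through auxiliary vectors. If D is 0 or 2 modulo 3, a suitable
    direction modulo 3 is given by v plus or minus its image under a square
    root of D ([direction_mod3]). If D is 1 modulo 3, the auxiliary vector has
    value 27 m with m prime to 3, and the cube 27 does not affect the symbols
    ([trivial_symbol_isotropic]).

    In all this one of the two arguments of the reciprocity law is rational
    ([cubic_reciprocity_rational]). This case follows from the cubic Gauss sum g
    of a primary prime pi of norm p, which satisfies g^3 = p pi: in a finite
    field whose characteristic is a prime q other than p, raising g to the norm
    of a prime above q gives the symbol of p pi over that prime. *)

Set Implicit Arguments.
Unset Strict Implicit.
Unset Printing Implicit Defensive.

Import Order.TTheory GRing.Theory Num.Theory.

Local Open Scope ring_scope.

(** * The ring of Eisenstein integers *)

Section EisensteinIntegers.

Implicit Types z w u v d alpha beta pi : eisenstein.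

Lemma eisP (z w : eisenstein) : ere z = ere w -> eom z = eom w -> z = w.
Proof. by case: z w => [a b] [c d] /= -> ->. Qed.

Lemma ereD z w : ere (z + w) = ere z + ere w. Proof. by []. Qed.
Lemma eomD z w : eom (z + w) = eom z + eom w. Proof. by []. Qed.
Lemma ereN z : ere (- z) = - ere z. Proof. by []. Qed.
Lemma eomN z : eom (- z) = - eom z. Proof. by []. Qed.
Lemma ereM z w : ere (z * w) = ere z * ere w - eom z * eom w.
Proof. by []. Qed.
Lemma eomM z w : eom (z * w) = ere z * eom w + eom z * ere w - eom z * eom w.
Proof. by []. Qed.

Lemma eis_int n : n%:~R = Eisenstein n 0.
Proof.
case: n => n.
  rewrite -pmulrn; elim: n => [|n IHn] //.
  by rewrite mulrS IHn; apply: eisP => //=; rewrite -[n.+1]add1n PoszD.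
rewrite NegzE mulrNz -pmulrn.
suff -> : n.+1%:R = Eisenstein n.+1 0 by apply: eisP.
elim: n => [|n IHn] //.
by rewrite mulrS IHn; apply: eisP => //=; rewrite -[n.+2]add1n PoszD.
Qed.

Lemma ere_int n : ere n%:~R = n. Proof. by rewrite eis_int. Qed.
Lemma eom_int n : eom n%:~R = 0. Proof. by rewrite eis_int. Qed.
Lemma ere_nat n : ere n%:R = n. Proof. by rewrite pmulrn ere_int. Qed.
Lemma eom_nat n : eom n%:R = 0. Proof. by rewrite pmulrn eom_int. Qed.

Definition eisE := (ereD, eomD, ereN, eomN, ereM, eomM, ere_int, eom_int,
  ere_nat, eom_nat).

Lemma eis_omega2 : omega ^+ 2 + omega + 1 = 0. Proof. by apply: eisP. Qed.
Lemma omega3 : omega ^+ 3 = 1. Proof. by apply: eisP. Qed.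

Lemma eis_eta z : z = (ere z)%:~R + (eom z)%:~R * omega.
Proof. by apply: eisP; rewrite !eisE /=; ring. Qed.

(** * Conjugation, norm and divisibility *)

Definition eis_conj (z : eisenstein) := Eisenstein (ere z - eom z) (- eom z).

Fact eis_conj_zmod : zmod_morphism eis_conj.
Proof. by move=> z w; apply: eisP => /=; ring. Qed.
Fact eis_conj_monoid : monoid_morphism eis_conj.
Proof. by split=> [|z w]; apply: eisP => //=; ring. Qed.
HB.instance Definition _ :=
  GRing.isZmodMorphism.Build eisenstein eisenstein eis_conj eis_conj_zmod.
HB.instance Definition _ :=
  GRing.isMonoidMorphism.Build eisenstein eisenstein eis_conj eis_conj_monoid.

Lemma eis_conjK : involutive eis_conj.
Proof. by move=> z; apply: eisP => /=; ring. Qed.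

Lemma eis_normE z : (eis_norm z)%:~R = z * eis_conj z.
Proof. by apply: eisP; rewrite !eisE /eis_norm /=; ring. Qed.

Lemma eis_normM z w : eis_norm (z * w) = eis_norm z * eis_norm w.
Proof. by rewrite /eis_norm !eisE; ring. Qed.
Lemma eis_norm_conj z : eis_norm (eis_conj z) = eis_norm z.
Proof. by rewrite /eis_norm /=; ring. Qed.
Lemma eis_norm_int n : eis_norm n%:~R = n ^+ 2.
Proof. by rewrite /eis_norm !eisE; ring. Qed.
Lemma eis_normN z : eis_norm (- z) = eis_norm z.
Proof. by rewrite /eis_norm !eisE; ring. Qed.
Lemma eis_norm1 : eis_norm 1 = 1. Proof. by []. Qed.

Lemma eis_norm4 z : 4 * eis_norm z = (2 * ere z - eom z) ^+ 2 + 3 * eom z ^+ 2.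
Proof. by rewrite /eis_norm; ring. Qed.

Lemma eis_norm_ge0 z : 0 <= eis_norm z.
Proof.
rewrite -(pmulr_rge0 _ (_ : 0 < 4 :> int)) // eis_norm4 addr_ge0 ?sqr_ge0 //.
by rewrite mulr_ge0 ?sqr_ge0.
Qed.

Lemma eis_norm_eq0 z : (eis_norm z == 0) = (z == 0).
Proof.
apply/eqP/eqP => [Nz|->//].
have := eis_norm4 z; rewrite Nz mulr0 => /esym/eqP.
rewrite paddr_eq0 ?sqr_ge0 //; last by rewrite mulr_ge0 ?sqr_ge0.
rewrite sqrf_eq0 mulf_eq0 sqrf_eq0 /= => /andP[/eqP h1 /eqP h2].
by apply: eisP; rewrite /= ?h2 //; move: h1; rewrite h2; lia.
Qed.

Lemma eis_norm_gt0 z : z != 0 -> 0 < eis_norm z.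
Proof. by move=> z0; rewrite lt_def eis_norm_ge0 eis_norm_eq0 z0. Qed.

Lemma eis_mulf_eq0 z w : z * w = 0 -> z = 0 \/ w = 0.
Proof.
move/eqP; rewrite -eis_norm_eq0 eis_normM mulf_eq0 !eis_norm_eq0.
by case/orP=> /eqP; [left | right].
Qed.

Lemma eis_mulIf z : z != 0 -> injective (fun x => x * z).
Proof.
move=> /eqP z0 x y /= /eqP; rewrite -subr_eq0 -mulrBl => /eqP /eis_mulf_eq0 [|//].
by move/eqP; rewrite subr_eq0 => /eqP.
Qed.

Lemma eis_dvdxx z : eis_dvd z z. Proof. by exists 1; rewrite mul1r. Qed.
Lemma eis_dvd_mull z u w : eis_dvd z w -> eis_dvd z (u * w).
Proof. by case=> k ->; exists (u * k); rewrite mulrA. Qed.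
Lemma eis_dvd_mulr z u w : eis_dvd z w -> eis_dvd z (w * u).
Proof. by rewrite mulrC; apply: eis_dvd_mull. Qed.
Lemma eis_dvdD z u w : eis_dvd z u -> eis_dvd z w -> eis_dvd z (u + w).
Proof. by case=> k -> [l ->]; exists (k + l); rewrite mulrDl. Qed.
Lemma eis_dvdN z u : eis_dvd z u -> eis_dvd z (- u).
Proof. by case=> k ->; exists (- k); rewrite mulNr. Qed.
Lemma eis_dvdB z u w : eis_dvd z u -> eis_dvd z w -> eis_dvd z (u - w).
Proof. by move=> zu zw; apply: eis_dvdD (eis_dvdN zw). Qed.
Lemma eis_dvd0 z : eis_dvd z 0. Proof. by exists 0; rewrite mul0r. Qed.
Lemma eis_dvd_trans z u w : eis_dvd z u -> eis_dvd u w -> eis_dvd z w.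
Proof. by case=> k -> [l ->]; exists (l * k); rewrite mulrA. Qed.
Lemma eis_dvd_conj z w : eis_dvd z w -> eis_dvd (eis_conj z) (eis_conj w).
Proof. by case=> k ->; exists (eis_conj k); rewrite rmorphM. Qed.

Lemma eis_dvd_norm z w : eis_dvd z w -> (eis_norm z %| eis_norm w)%Z.
Proof. by case=> k ->; rewrite eis_normM dvdz_mull. Qed.

Lemma eis_dvd_self_norm z : eis_dvd z (eis_norm z)%:~R.
Proof. by rewrite eis_normE mulrC; apply: eis_dvd_mull; apply: eis_dvdxx. Qed.

Lemma eis_dvd_int (m n : int) : (m %| n)%Z -> eis_dvd m%:~R n%:~R.
Proof. by case/dvdzP=> k ->; exists k%:~R; rewrite -intrM. Qed.

Lemma eis_norm1_unit z : eis_norm z = 1 -> z * eis_conj z = 1.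
Proof. by move=> N1; rewrite -eis_normE N1. Qed.

Lemma eis_dvd1 z : eis_dvd z 1 <-> eis_norm z = 1.
Proof.
split=> [/eis_dvd_norm|/eis_norm1_unit <-].
  by rewrite eis_norm1 dvdz1; have := eis_norm_ge0 z; lia.
by rewrite mulrC; exists (eis_conj z).
Qed.

(** * Euclidean division and factorization into primary primes *)

Lemma int_round (x n : int) : 0 < n ->
  exists q, - n <= 2 * (x - n * q) <= n.
Proof.
move=> n0; exists ((2 * x + n) %/ (2 * n))%Z.
have n20 : 2 * n != 0 by lia.
have := divz_eq (2 * x + n) (2 * n); have := modz_ge0 (2 * x + n) n20.
have := ltz_pmod (2 * x + n) (_ : 0 < 2 * n).
set q := (_ %/ _)%Z; set m := (_ %% _)%Z => /(_ ltac:(lia)).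
have -> : q * (2 * n) = 2 * (n * q) by ring.
lia.
Qed.

(** Rounding both coordinates of the quotient leaves a remainder of norm at
    most 3/4 of that of the divisor. *)
Lemma eis_edivP z d : d != 0 -> exists q, eis_norm (z - q * d) < eis_norm d.
Proof.
move=> d0; have N0 := eis_norm_gt0 d0.
set n := eis_norm d in N0 *.
have [x hx] := int_round (ere (z * eis_conj d)) N0.
have [y hy] := int_round (eom (z * eis_conj d)) N0.
exists (Eisenstein x y); set r := z - _.
have Er : r * eis_conj d = z * eis_conj d - n%:~R * Eisenstein x y.
  by rewrite eis_normE /r; ring.
have : eis_norm (r * eis_conj d) = eis_norm r * n.
  by rewrite eis_normM eis_norm_conj.
rewrite {1}/eis_norm Er; move: (z * eis_conj d) hx hy => w hx hy.
have -> : ere (w - n%:~R * Eisenstein x y) = ere w - n * x.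
  by rewrite !eisE /=; ring.
have -> : eom (w - n%:~R * Eisenstein x y) = eom w - n * y.
  by rewrite !eisE /=; ring.
move: hx hy; set s := _ - n * x; set t := _ - n * y => hs ht EN.
rewrite -(ltr_pM2r N0) -EN.
have s1 : 0 <= (n - 2 * s) * (n + 2 * s) by apply: mulr_ge0; lia.
have t1 : 0 <= (n - 2 * t) * (n + 2 * t) by apply: mulr_ge0; lia.
have st : 0 <= (s + t) ^+ 2 by apply: sqr_ge0.
have nn : 0 < n * n by apply: mulr_gt0.
nra.
Qed.
Lemma eis_bezout z w : exists d u v,
  [/\ d = u * z + v * w, eis_dvd d z & eis_dvd d w].
Proof.
have [n] := ubnP `|eis_norm w|%N; elim: n z w => // n IHn z w le_w.
have [->|w0] := eqVneq w 0.
  by exists z, 1, 0; split; [ring | apply: eis_dvdxx | apply: eis_dvd0].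
have [q lt_q] := eis_edivP z w0.
have [|d [u [v [Ed d1 d2]]]] := IHn w (z - q * w).
  have := eis_norm_ge0 w; have := eis_norm_ge0 (z - q * w); lia.
exists d, v, (u - v * q); split=> //; first by rewrite Ed; ring.
by rewrite -[z](subrK (q * w)); apply: eis_dvdD => //; apply: eis_dvd_mull.
Qed.

Lemma eis_prime_bezout pi z : eis_prime pi ->
  eis_dvd pi z \/ exists u v, u * pi + v * z = 1.
Proof.
case=> pi0 pi1 piP; have [d [u [v [Ed [k Ek] dz]]]] := eis_bezout pi z.
have := piP k d; rewrite -Ek => /(_ (eis_dvdxx _)) [|pid]; last first.
  by left; apply: eis_dvd_trans dz.
case=> l El; right; have : (l * d - 1) * pi = 0 by rewrite mulrBl mul1r {2}Ek El; ring.
case/eis_mulf_eq0 => [/eqP|pi00]; last by rewrite pi00 eqxx in pi0.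
rewrite subr_eq0 Ed => /eqP ld1; exists (l * u), (l * v).
by rewrite -ld1; ring.
Qed.

(** A divisor of least norm among those that are not units is prime: by
    Bezout, its greatest common divisor with any element is a unit or an
    associate of it. *)
Lemma eis_prime_exists z : z != 0 -> eis_norm z != 1 ->
  exists2 pi, eis_prime pi & eis_dvd pi z.
Proof.
have [n] := ubnP `|eis_norm z|%N; elim: n z => // n IHn z le_z z0 z1.
have [[d [dz d1 ltd]]|hz] := pselect (exists d,
    [/\ eis_dvd d z, eis_norm d != 1 & eis_norm d < eis_norm z]).
  have d0 : d != 0.
    by apply: contraNneq z0 => d0; case: dz => k ->; rewrite d0 mulr0.
  have [|pi piP pid] := IHn d _ d0 d1; last by exists pi => //; apply: eis_dvd_trans dz.
  by have := eis_norm_ge0 d; lia.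
exists z; last exact: eis_dvdxx.
split=> //; first by move/eis_dvd1 => N1; rewrite N1 in z1.
move=> u v zuv; have [d [k [l [Ed [e Ee] du]]]] := eis_bezout z u.
have [Nd|Nd] := eqVneq (eis_norm d) 1.
  right; have := eis_norm1_unit Nd => d1.
  have -> : v = d * eis_conj d * v by rewrite d1 mul1r.
  have -> : d * eis_conj d * v = eis_conj d * (k * v) * z + eis_conj d * l * (u * v).
    by rewrite {1}Ed; ring.
  by apply: eis_dvdD; [exists (eis_conj d * (k * v)) | apply: eis_dvd_mull].
left; have Ne : eis_norm e = 1.
  apply: contrapT => Ne; apply: hz; exists d; split=> //; first by exists e.
  have d0 : d != 0 by apply: contraNneq z0 => d0; rewrite Ee d0 mulr0.
  have e0 : e != 0 by apply: contraNneq z0 => e0; rewrite Ee e0 mul0r.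
  rewrite Ee eis_normM; have := eis_norm_gt0 d0; have := eis_norm_gt0 e0.
  move: Ne; set a := eis_norm e; set b := eis_norm d => *; nia.
apply: eis_dvd_trans du; exists (eis_conj e).
by rewrite Ee mulrA [_ * e]mulrC eis_norm1_unit // mul1r.
Qed.

Lemma eis_norm_sq z : eis_norm z = (ere z + eom z) ^+ 2 - 3 * (ere z * eom z).
Proof. by rewrite /eis_norm; ring. Qed.

Lemma eis_norm_dvd3 z : (3 %| eis_norm z)%Z = (3 %| ere z + eom z)%Z.
Proof.
rewrite eis_norm_sq; move: (ere z + eom z) (ere z * eom z) => x y.
have -> : (3 %| x ^+ 2 - 3 * y)%Z = (3 %| x ^+ 2)%Z by lia.
by rewrite !dvdzE abszX Euclid_dvdX ?andbT.
Qed.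

(** Equivalently, congruent to 1 or -1 modulo 3. These are the elements which
    are products of primary primes up to sign. *)
Definition primary_up_to_sign z := ~~ (3 %| ere z)%Z && (3 %| eom z)%Z.

Lemma primary_up_to_sign_norm z :
  primary_up_to_sign z -> ~~ (3 %| eis_norm z)%Z.
Proof. by rewrite eis_norm_dvd3 => /andP[]; lia. Qed.

Lemma primary_primary_up_to_sign pi : eis_primary pi -> primary_up_to_sign pi.
Proof. by case=> h1 h2; rewrite /primary_up_to_sign h2; lia. Qed.

Lemma primary_up_to_sign_quot z pi : eis_primary pi ->
  primary_up_to_sign (z * pi) -> primary_up_to_sign z.
Proof.
case=> h1 h2; rewrite /primary_up_to_sign !eisE.
have [k ->] : exists k, ere pi = 3 * k + 2.
  by exists (ere pi %/ 3)%Z; rewrite {1}(divz_eq (ere pi) 3) h1 mulrC.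
have [l ->] : exists l, eom pi = 3 * l by exists (eom pi %/ 3)%Z; lia.
rewrite !mulrDr ![_ * (3 * _)]mulrCA; lia.
Qed.

(** The six units permute the six classes modulo 3 prime to 3 simply
    transitively, so that one associate falls in the class of 2. *)
Lemma primary_associate z : ~~ (3 %| eis_norm z)%Z ->
  exists2 e, eis_norm e = 1 & eis_primary (e * z).
Proof.
rewrite eis_norm_dvd3 => h.
suff [e e1 [h1 h2]] : exists2 e, eis_norm e = 1 &
    ~~ (3 %| ere (e * z))%Z /\ (3 %| eom (e * z))%Z.
  have [p|p] := boolP ((ere (e * z) %% 3)%Z == 2).
    by exists e => //; split=> //; apply/eqP.
  exists (- e); rewrite ?eis_normN // mulNr; split; rewrite !eisE.
    by move: h1 p; rewrite !eisE; lia.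
  by move: h2; rewrite !eisE; lia.
have [b0|b0] := boolP (3 %| eom z)%Z.
  by exists 1 => //; rewrite mul1r; split=> //; lia.
have [a0|a0] := boolP (3 %| ere z)%Z.
  exists (omega * omega) => //; rewrite !eisE /=; split; lia.
exists omega => //; rewrite !eisE /=; split; lia.
Qed.

Lemma eis_unit_sign e : eis_norm e = 1 -> primary_up_to_sign e -> e = 1 \/ e = -1.
Proof.
move=> N1 /andP[_ /dvdzP[k Ek]]; have := eis_norm4 e; rewrite N1 Ek => E4.
have k0 : k = 0 by nia.
have : (ere e) ^+ 2 = 1 by move: E4; rewrite k0; lia.
move/eqP; rewrite sqrf_eq1 => /orP[] /eqP Ee; [left | right]; apply: eisP;
  by rewrite ?Ee ?Ek ?k0.
Qed.

Lemma primary_associate_eq pi e : eis_norm e = 1 -> eis_primary pi ->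
  eis_primary (e * pi) -> e = 1.
Proof.
move=> N1 Pp Pe; have := primary_up_to_sign_quot Pp (primary_primary_up_to_sign Pe).
case/(eis_unit_sign N1) => // E; move: Pp Pe; rewrite E mulN1r => -[h1 _] [h2 _].
by move: h1 h2; rewrite !eisE; lia.
Qed.

Lemma eis_prime_dvd_norm1 pi pi' : eis_prime pi -> eis_prime pi' ->
  eis_dvd pi pi' -> exists2 e, eis_norm e = 1 & pi' = e * pi.
Proof.
move=> [p0 p1 _] [p'0 _ pP'] [e Ee]; exists e => //.
have [|[k Ek]|[k Ek]] := pP' e pi; first by rewrite -Ee; apply: eis_dvdxx.
  case: p1; exists k; apply: (eis_mulIf p'0) => /=.
  by rewrite mul1r {1}Ee Ek; ring.
apply/eis_dvd1; exists k; apply: (eis_mulIf p'0) => /=.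
by rewrite mul1r {1}Ee {1}Ek; ring.
Qed.

Lemma eis_prime_associate pi e : eis_norm e = 1 -> eis_prime pi -> eis_prime (e * pi).
Proof.
move=> /eis_norm1_unit e1 [p0 p1 pP].
have h z : eis_dvd (e * pi) z <-> eis_dvd pi z.
  split=> [|[k ->]]; first by apply: eis_dvd_trans; exists e.
  by exists (k * eis_conj e); rewrite -[k * pi]mul1r -e1; ring.
split=> [||u v /h /pP []].
- apply: contraNneq p0 => ep; rewrite -[pi]mul1r -e1 [e * _]mulrC -mulrA ep.
  by rewrite mulr0.
- by move/h.
- by left; apply/h.
- by right; apply/h.
Qed.

Definition primary_primes (s : seq eisenstein) :=
  forall pi, pi \in s -> eis_prime pi /\ eis_primary pi.

Lemma primary_factorization_exists z : primary_up_to_sign z ->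
  exists s, primary_factorization z s.
Proof.
have [n] := ubnP `|eis_norm z|%N; elim: n z => // n IHn z le_z hz.
have [N1|N1] := eqVneq (eis_norm z) 1.
  by exists [::]; split=> //; rewrite big_nil; apply: eis_unit_sign.
have z0 : z != 0 by apply: contraTneq hz => ->.
have [rho Prho rz] := eis_prime_exists z0 N1.
have Nr3 : ~~ (3 %| eis_norm rho)%Z.
  apply: contra (primary_up_to_sign_norm hz) => h.
  exact: dvdz_trans h (eis_dvd_norm rz).
have [e e1 Pp] := primary_associate Nr3.
have Pq := eis_prime_associate e1 Prho.
set pi := e * rho in Pp Pq.
have [y Ey] : eis_dvd pi z.
  case: rz => k Ek; exists (k * eis_conj e).
  by rewrite Ek /pi -[k * rho]mul1r -(eis_norm1_unit e1); ring.
have [||s [hs Es]] := IHn y.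
- have y0 : y != 0 by apply: contraNneq z0 => y0; rewrite Ey y0 mul0r.
  have [p0 p1 _] := Pq; have := eis_norm_gt0 y0; have := eis_norm_gt0 p0.
  have p1' : eis_norm pi <> 1 by move/eis_dvd1.
  move: le_z p1'; rewrite Ey eis_normM; set a := eis_norm y; set b := eis_norm pi.
  by move=> *; nia.
- by apply: (primary_up_to_sign_quot Pp); rewrite -Ey.
exists (pi :: s); split.
  by move=> x; rewrite inE => /orP[/eqP->//|/hs].
rewrite big_cons Ey mulrC; case: Es => ->; [left|right] => //.
by rewrite mulrN.
Qed.

Lemma eis_prime_dvd_prod pi s : eis_prime pi ->
  eis_dvd pi (\prod_(x <- s) x) -> exists2 x, x \in s & eis_dvd pi x.
Proof.
move=> Pp; elim: s => [|x s IHs]; first by rewrite big_nil; case: Pp.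
rewrite big_cons; case: (Pp) => _ _ pP /pP [px|/IHs [y ys py]].
  by exists x; rewrite ?mem_head.
by exists y => //; rewrite inE ys orbT.
Qed.

Lemma primary_prime_dvd_eq pi pi' : eis_prime pi -> eis_primary pi ->
  eis_prime pi' -> eis_primary pi' -> eis_dvd pi pi' -> pi = pi'.
Proof.
move=> P1 Q1 P2 Q2 /(eis_prime_dvd_norm1 P1 P2) [e e1 Ee].
by move: Q2; rewrite Ee => /(primary_associate_eq e1 Q1) ->; rewrite mul1r.
Qed.

(** Associated primary primes are equal, so unique factorization holds with
    no ambiguity of units but the global sign. *)
Lemma primary_primes_uniq s1 s2 : primary_primes s1 -> primary_primes s2 ->
  (\prod_(x <- s1) x = \prod_(x <- s2) x \/
   \prod_(x <- s1) x = - \prod_(x <- s2) x) -> perm_eq s1 s2.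
Proof.
elim: s1 s2 => [|x s1 IHs] s2 h1 h2.
  rewrite big_nil; case: s2 h2 => [//|y s2] h2.
  have [[_ y1 _] _] := h2 y (mem_head _ _); rewrite big_cons => h; case: y1.
  case: h => [->|h]; first by apply: eis_dvd_mulr; apply: eis_dvdxx.
  by rewrite h; apply: eis_dvdN; apply: eis_dvd_mulr; apply: eis_dvdxx.
have [Px Qx] := h1 x (mem_head _ _); rewrite big_cons => h.
have xs2 : eis_dvd x (\prod_(y <- s2) y).
  case: h => h; first by rewrite -h; apply: eis_dvd_mulr; apply: eis_dvdxx.
  rewrite -[\prod_(y <- s2) y]opprK -h; apply: eis_dvdN.
  by apply: eis_dvd_mulr; apply: eis_dvdxx.
have [y ys2 xy] := eis_prime_dvd_prod Px xs2.
have [Py Qy] := h2 y ys2; have Exy := primary_prime_dvd_eq Px Qx Py Qy xy.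
subst y; have ps := perm_to_rem ys2; rewrite (permPr ps) perm_cons.
apply: IHs => [z zs|z zs|].
- by apply: h1; rewrite inE zs orbT.
- by apply: h2; apply: mem_rem zs.
have x0 : x != 0 by case: Px.
move: h; rewrite !(perm_big _ ps) !big_cons /=.
case=> h; [left | right]; apply: (eis_mulIf x0) => /=.
  by rewrite mulrC h mulrC.
by rewrite mulrC h mulNr [x * _]mulrC.
Qed.

Lemma eis_conj_prime pi : eis_prime pi -> eis_prime (eis_conj pi).
Proof.
case=> p0 p1 pP; split=> [||u v].
- by rewrite -eis_norm_eq0 eis_norm_conj eis_norm_eq0.
- by move/eis_dvd1; rewrite eis_norm_conj => /eis_dvd1.
move/eis_dvd_conj; rewrite eis_conjK rmorphM => /pP [] /eis_dvd_conj;
  rewrite eis_conjK; [left|right]; assumption.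
Qed.

Lemma eis_conj_primary pi : eis_primary pi -> eis_primary (eis_conj pi).
Proof. by case=> h1 h2; split=> /=; lia. Qed.

(** * Residue fields *)

Lemma eis_rmorphism (R : comNzRingType) (w : R) : w ^+ 2 + w + 1 = 0 ->
  {f : {rmorphism eisenstein -> R} | f omega = w}.
Proof.
move=> Ew; pose f (z : eisenstein) : R := (ere z)%:~R + (eom z)%:~R * w.
have fB : zmod_morphism f.
  by move=> x y; rewrite /f !eisE !(intrD, mulrNz); ring.
have fM : monoid_morphism f.
  split=> [|x y]; first by rewrite /f /= mul0r addr0.
  rewrite /f !eisE !(intrD, mulrNz, intrM).
  have Ew2 : w ^+ 2 = - w - 1 by apply/eqP; rewrite -subr_eq0 -Ew; apply/eqP; ring.
  by ring: Ew2.
pose m := GRing.isZmodMorphism.Build _ _ f fB.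
pose m' := GRing.isMonoidMorphism.Build _ _ f fM.
pose F : {rmorphism eisenstein -> R} := HB.pack f m m'.
by exists F; rewrite /= /f /= mul1r add0r.
Qed.

Lemma primitive_cube_root_eq (F : fieldType) (w : F) :
  3.-primitive_root w -> w ^+ 2 + w + 1 = 0.
Proof.
move=> w3; have w1 : w - 1 != 0.
  by rewrite subr_eq0 -[w]expr1 -(prim_order_dvd w3).
apply: (mulfI w1); rewrite mulr0.
have -> : (w - 1) * (w ^+ 2 + w + 1) = w ^+ 3 - 1 by ring.
by rewrite (prim_expr_order w3) subrr.
Qed.

Lemma finField_primitive_root (F : finFieldType) n : (n %| #|F|.-1)%N ->
  exists z : F, n.-primitive_root z.
Proof.
move=> ndvd; have F1 := finNzRing_gt1 F.
have F0 : (0 < #|F|.-1)%N by case: #|F| F1 => [|[]].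
have [|||z _ /dvdn_prim_root zP] := hasP (has_prim_root F0 (rs := enum (predC1 (0 : F))) _ _ _).
- apply/allP => x; rewrite mem_enum inE => x0; apply/unity_rootP.
  by apply: (mulfI x0); rewrite -exprS prednK ?(ltnW F1) // expf_card mulr1.
- exact: enum_uniq.
- by rewrite -cardE cardC1.
by exists (z ^+ (#|F|.-1 %/ n)); apply: zP.
Qed.

Lemma finField_cube_root (F : finFieldType) : (3 %| #|F|.-1)%N ->
  exists w : F, w ^+ 2 + w + 1 = 0.
Proof.
by case/finField_primitive_root=> w /primitive_cube_root_eq; exists w.
Qed.

Lemma eis_rmorphE (R : pzRingType) (f : {rmorphism eisenstein -> R}) z :
  f z = (ere z)%:~R + (eom z)%:~R * f omega.
Proof. by rewrite {1}[z]eis_eta rmorphD rmorphM !rmorph_int. Qed.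

(** An element not divisible by [pi] is invertible modulo [pi] by Bezout, and
    a ring morphism does not kill a unit. *)
Lemma eis_rmorph_ker (R : nzRingType) (f : {rmorphism eisenstein -> R}) pi z :
  eis_prime pi -> f pi = 0 -> f z = 0 <-> eis_dvd pi z.
Proof.
move=> Pp f0; split=> [fz|[k ->]]; last by rewrite rmorphM f0 mulr0.
have [//|[u [v Euv]]] := eis_prime_bezout z Pp.
have /eqP := rmorph1 f; rewrite -Euv rmorphD !rmorphM f0 fz !mulr0 addr0.
by rewrite eq_sym oner_eq0.
Qed.

Lemma eis_prime_dvd_pX pi z n : eis_prime pi -> eis_dvd pi (z ^+ n) -> eis_dvd pi z.
Proof.
move=> Pp; elim: n => [|n IHn]; first by rewrite expr0; case: Pp.
by rewrite exprS; case: (Pp) => _ _ pP /pP [].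
Qed.

Lemma eis_prime_dvd_rational_prime pi : eis_prime pi ->
  exists2 q : nat, prime q & eis_dvd pi q%:R.
Proof.
move=> Pp; have [p0 p1 pP] := Pp.
have [n n0 Nn] : exists2 n : nat, (0 < n)%N & eis_dvd pi n%:R.
  exists `|eis_norm pi|%N; first by have := eis_norm_gt0 p0; lia.
  rewrite pmulrn gez0_abs ?eis_norm_ge0 //; exact: eis_dvd_self_norm.
elim/ltn_ind: n n0 Nn => n IHn n0 Nn.
have [n1|n1] := leqP n 1.
  by case: p1; move: Nn; have -> : n = 1%N by lia.
have Pq := pdiv_prime n1.
have En : n%:R = (n %/ pdiv n)%:R * (pdiv n)%:R :> eisenstein.
  by rewrite -natrM divnK ?pdiv_dvd.
move: Nn; rewrite En => /pP [h|h]; last by exists (pdiv n).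
apply: (IHn (n %/ pdiv n)%N) => //.
  by rewrite ltn_Pdiv ?prime_gt1.
by rewrite divn_gt0 ?prime_gt0 // dvdn_leq ?pdiv_dvd.
Qed.

Lemma primary_norm_mod3 pi : eis_primary pi -> (3 %| eis_norm pi - 1)%Z.
Proof.
case=> h1 h2; rewrite eis_norm_sq.
have [k Ek] : exists k, ere pi + eom pi = 3 * k + 2.
  exists ((ere pi + eom pi) %/ 3)%Z; lia.
rewrite Ek; move: (ere pi * eom pi) => y; rewrite !expr2; lia.
Qed.

(** The norm divides the square of the rational prime [q] below [pi]. If it is
    [q ^ 2], then [pi] is [q] up to a unit, and this unit is a sign because
    [pi] is primary. *)
Lemma primary_prime_classify pi : eis_prime pi -> eis_primary pi ->
  exists q k : nat, [/\ prime q, q != 3%N, eis_dvd pi q%:R,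
    eis_norm pi = (q ^ k)%N &
    k = 1%N \/ (exists n : int, pi = n%:~R)].
Proof.
move=> Pp Qp; have [q Pq pq] := eis_prime_dvd_rational_prime Pp.
have N0 := eis_norm_ge0 pi.
have := eis_dvd_norm pq; rewrite pmulrn eis_norm_int dvdzE abszX absz_nat.
case/(dvdn_pfactor _ _ Pq) => k k2 Ek.
have N3 := primary_norm_mod3 Qp.
have EN : eis_norm pi = (q ^ k)%N by rewrite -Ek gez0_abs.
have k0 : k != 0%N.
  have [_ p1 _] := Pp; apply: contra_not_neq p1 => k0.
  by apply/eis_dvd1; rewrite EN k0.
exists q, k; split=> //.
  apply: contraTneq N3 => q3; rewrite EN q3; case: k {Ek k2 EN} k0 => // k _.
  rewrite expnS; lia.
case: k k0 k2 Ek EN => [//|[_ _ _ _|[_ _ _ EN|//]]]; first by left.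
right; have [e Ee] := pq.
have Ne : eis_norm e = 1.
  have := congr1 eis_norm Ee; rewrite pmulrn eis_norm_int eis_normM EN.
  have := prime_gt0 Pq; rewrite -mulnn PoszM expr2; move: (eis_norm e) => x; nia.
have e1 := eis_norm1_unit Ne.
have := primary_primary_up_to_sign Qp.
have q3 : ~~ (3 %| q)%N.
  apply: contraL N3 => q3; rewrite EN; move: q3; rewrite expnS; lia.
have Sq : primary_up_to_sign q%:R by rewrite /primary_up_to_sign ere_nat eom_nat; lia.
move: Sq; rewrite Ee => /(primary_up_to_sign_quot Qp) /(eis_unit_sign Ne).
case=> ee _; [exists q%:Z | exists (- q%:Z)].
  by rewrite -pmulrn Ee ee mul1r.
by rewrite mulrNz -pmulrn Ee ee mulN1r opprK.
Qed.

(** The map sending omega to [w] kills the norm of [pi], hence [pi] or its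
    conjugate; in the second case composing it with conjugation kills [pi]. *)
Lemma eis_rmorphism_killing (F : fieldType) (w : F) pi (q k : nat) :
  w ^+ 2 + w + 1 = 0 -> q \in [pchar F] -> (0 < k)%N ->
  eis_norm pi = (q ^ k)%N ->
  exists f : {rmorphism eisenstein -> F}, f pi = 0.
Proof.
move=> Ew qF k0 EN; have [f _] := eis_rmorphism Ew.
have : f pi * f (eis_conj pi) = 0.
  rewrite -rmorphM -eis_normE rmorph_int EN -pmulrn natrX (pcharf0 qF).
  by rewrite expr0n (gtn_eqF k0).
move/eqP; rewrite mulf_eq0 => /orP[] /eqP fpi; first by exists f.
by exists (GRing.RMorphism.clone _ _ (f \o eis_conj) _).
Qed.

Lemma eis_rmorph_Frobenius (F : fieldType) (f : {rmorphism eisenstein -> F})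
    (q k : nat) z : q \in [pchar F] -> (q ^ k %% 3 = 1)%N ->
  f z ^+ (q ^ k) = f z.
Proof.
move=> qF qk1; have Fint n : (n%:~R : F) ^+ (q ^ k) = n%:~R.
  elim: k {qk1} => [|k IHk]; first by rewrite expn0 expr1.
  by rewrite expnSr exprM IHk -(pFrobenius_autE qF) pFrobenius_aut_int.
rewrite eis_rmorphE exprDn_pchar; last first.
  by rewrite pnatX pnatE ?(pcharf_prime qF) ?qF.
rewrite exprMn !Fint; congr (_ + _ * _).
rewrite -rmorphXn (divn_eq (q ^ k) 3) qk1 exprD mulnC exprM omega3 expr1n mul1r.
by rewrite expr1.
Qed.

(** A field with [q ^ 2] elements contains the residue fields of all primes
    above [q]. *)
Lemma eis_residue_field pi : eis_prime pi -> eis_primary pi ->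
  exists (F : finFieldType) (f : {rmorphism eisenstein -> F}),
    f pi = 0 /\ forall z, f z ^+ `|eis_norm pi|%N = f z.
Proof.
move=> Pp Qp; have [q [k [Pq q3 _ EN _]]] := primary_prime_classify Pp Qp.
have N3 := primary_norm_mod3 Qp.
have [|F qF cF] := @pPrimePowerField q 2 Pq; first by [].
have k0 : (0 < k)%N.
  have [_ p1 _] := Pp; rewrite lt0n; apply: contra_not_neq p1 => k0.
  by apply/eis_dvd1; rewrite EN k0.
have [|w Ew] := @finField_cube_root F.
  rewrite cF -subn1 -[X in (_ - X)%N](exp1n 2) subn_sqr.
  have : ~~ (3 %| q)%N by rewrite dvdn_prime2 // eq_sym.
  move=> h; have : ((q - 1) %% 3 == 0)%N || ((q + 1) %% 3 == 0)%N.
    by have := prime_gt0 Pq; move: h; lia.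
  by case/orP=> h'; [apply: dvdn_mulr | apply: dvdn_mull].
have [f f0] := eis_rmorphism_killing Ew qF k0 EN.
exists F, f; split=> // z; rewrite EN; apply: eis_rmorph_Frobenius => //.
have := prime_gt0 Pq; move: N3; rewrite EN; move: (q ^ k)%N => n; lia.
Qed.

(** * The cubic residue symbol *)

Definition cubic_values : seq eisenstein := [:: 0; 1; omega; omega ^+ 2].

Lemma cubic_valuesM x y : x \in cubic_values -> y \in cubic_values ->
  x * y \in cubic_values.
Proof. by rewrite !inE => /or4P[] /eqP-> /or4P[] /eqP->. Qed.

Lemma cubic_values_conj x : x \in cubic_values -> eis_conj x \in cubic_values.
Proof. by rewrite !inE => /or4P[] /eqP->. Qed.

Lemma cubic_values_cube x : x \in cubic_values -> x != 0 -> x ^+ 3 = 1.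
Proof. by rewrite !inE => /or4P[] /eqP-> // _; apply/eqP. Qed.

(** The difference of two of these values has norm 0, 1 or 3, and [pi] has
    norm prime to 3. *)
Lemma cubic_values_inj pi x y : eis_prime pi -> eis_primary pi ->
  x \in cubic_values -> y \in cubic_values -> eis_dvd pi (x - y) -> x = y.
Proof.
move=> Pp Qp hx hy hd; apply/eqP; rewrite -subr_eq0 -eis_norm_eq0.
have : (eis_norm (x - y) == 0) || (eis_norm (x - y) == 1) || (eis_norm (x - y) == 3).
  by move: hx hy {hd}; rewrite !inE => /or4P[] /eqP-> /or4P[] /eqP->.
have := primary_norm_mod3 Qp; have := eis_dvd_norm hd.
have [_ p1 _] := Pp; have {p1} : eis_norm pi <> 1 by move/eis_dvd1.
have := eis_norm_ge0 pi.
move: (eis_norm pi) (eis_norm (x - y)) => n m n0 n1 nm n3.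
case/orP=> [/orP[//|/eqP m1]|/eqP m3]; move: nm.
  by rewrite m1 dvdz1; lia.
by rewrite m3 dvdzE => /(dvdn_leq (isT : (0 < 3)%N)); lia.
Qed.

Definition cubic_exponent pi := ((`|eis_norm pi|%N).-1 %/ 3)%N.

Lemma cubic_exponentP pi : eis_prime pi -> eis_primary pi ->
  (0 < cubic_exponent pi)%N /\ `|eis_norm pi|%N = (cubic_exponent pi * 3).+1.
Proof.
move=> [p0 p1 _] /primary_norm_mod3; rewrite /cubic_exponent.
have {p1} : eis_norm pi <> 1 by move/eis_dvd1.
have := eis_norm_gt0 p0; lia.
Qed.

Lemma cubic_symbolP alpha pi : eis_prime pi -> eis_primary pi ->
  cubic_symbol alpha pi \in cubic_values /\
  eis_dvd pi (alpha ^+ cubic_exponent pi - cubic_symbol alpha pi).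
Proof.
move=> Pp Qp; have [e0 EN] := cubic_exponentP Pp Qp.
rewrite /cubic_symbol -/(cubic_exponent pi); case: asboolP => [pa|pa].
  split=> //; rewrite subr0 -(prednK e0) exprS; exact: eis_dvd_mulr.
case: pickP => [i /asboolP pi_i|no].
  by split=> //; clear pi_i; rewrite !inE; case: i => [[|[|[|i]]] //= _]; rewrite ?eqxx ?orbT.
have [F [f [f0 fN]]] := eis_residue_field Pp Qp.
have fa : f alpha != 0 by apply/eqP => /(eis_rmorph_ker _ Pp f0).
move: no; set y := alpha ^+ cubic_exponent pi => no.
have y3 : f (y ^+ 3) = 1.
  by apply: (mulfI fa); rewrite -rmorphM -exprM -exprS -EN rmorphXn fN mulr1.
have : eis_dvd pi ((y - 1) * ((y - omega) * (y - omega ^+ 2))).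
  apply/(eis_rmorph_ker _ Pp f0).
  have -> : (y - 1) * ((y - omega) * (y - omega ^+ 2)) =
     y ^+ 3 - omega ^+ 3 - (omega ^+ 2 + omega + 1) * (y ^+ 2 - omega * y).
    by ring.
  by rewrite eis_omega2 mul0r subr0 omega3 rmorphB y3 rmorph1 subrr.
have [_ _ pP] := Pp.
have no' (i : 'I_3) : ~ eis_dvd pi (y - omega ^+ i).
  by move=> h; have /asboolP := no i.
case/pP => [h|/pP[] h].
- by case: (no' (inord 0)); rewrite inordK.
- by case: (no' (inord 1)); rewrite inordK.
- by case: (no' (inord 2)); rewrite inordK.
Qed.

Lemma cubic_symbol_unique alpha pi x : eis_prime pi -> eis_primary pi ->
  x \in cubic_values -> eis_dvd pi (alpha ^+ cubic_exponent pi - x) ->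
  cubic_symbol alpha pi = x.
Proof.
move=> Pp Qp hx dx; have [hs ds] := cubic_symbolP alpha Pp Qp.
apply: (cubic_values_inj Pp Qp) => //.
set y := alpha ^+ _ in dx ds; set s := cubic_symbol _ _ in ds *.
have -> : s - x = (y - x) - (y - s) by ring.
exact: eis_dvdB.
Qed.

Lemma cubic_symbolM alpha beta pi : eis_prime pi -> eis_primary pi ->
  cubic_symbol (alpha * beta) pi = cubic_symbol alpha pi * cubic_symbol beta pi.
Proof.
move=> Pp Qp; have [h1 d1] := cubic_symbolP alpha Pp Qp.
have [h2 d2] := cubic_symbolP beta Pp Qp.
apply: cubic_symbol_unique => //; first exact: cubic_valuesM.
rewrite exprMn; move: h1 h2 d1 d2; set x := cubic_symbol _ _; set y := cubic_symbol _ _.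
move=> h1 h2; set a := alpha ^+ _; set b := beta ^+ _ => d1 d2.
have -> : a * b - x * y = a * (b - y) + y * (a - x) by ring.
by apply: eis_dvdD; apply: eis_dvd_mull.
Qed.

Lemma eis_dvd_subX pi alpha beta n :
  eis_dvd pi (alpha - beta) -> eis_dvd pi (alpha ^+ n - beta ^+ n).
Proof. by rewrite subrXX; apply: eis_dvd_mulr. Qed.

Lemma cubic_symbol_congr alpha beta pi : eis_prime pi -> eis_primary pi ->
  eis_dvd pi (alpha - beta) -> cubic_symbol alpha pi = cubic_symbol beta pi.
Proof.
move=> Pp Qp hd; have [h2 d2] := cubic_symbolP beta Pp Qp.
apply: cubic_symbol_unique => //.
rewrite -[_ - cubic_symbol _ _](subrKA (beta ^+ cubic_exponent pi)).
by apply: eis_dvdD => //; apply: eis_dvd_subX.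
Qed.

Lemma cubic_symbol_eq0 alpha pi : eis_prime pi -> eis_primary pi ->
  cubic_symbol alpha pi = 0 <-> eis_dvd pi alpha.
Proof.
move=> Pp Qp; split=> [s0|pa].
  have [_] := cubic_symbolP alpha Pp Qp; rewrite s0 subr0.
  exact: eis_prime_dvd_pX.
by rewrite /cubic_symbol; case: asboolP.
Qed.

Lemma cubic_symbol1 pi : eis_prime pi -> eis_primary pi -> cubic_symbol 1 pi = 1.
Proof.
move=> Pp Qp; apply: cubic_symbol_unique => //.
by rewrite expr1n subrr; apply: eis_dvd0.
Qed.

Lemma cubic_symbol_conj alpha pi : eis_prime pi -> eis_primary pi ->
  cubic_symbol (eis_conj alpha) (eis_conj pi) = eis_conj (cubic_symbol alpha pi).
Proof.
move=> Pp Qp; have [h d] := cubic_symbolP alpha Pp Qp.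
apply: cubic_symbol_unique.
- exact: eis_conj_prime.
- exact: eis_conj_primary.
- exact: cubic_values_conj.
by rewrite /cubic_exponent eis_norm_conj -rmorphXn -rmorphB; apply: eis_dvd_conj.
Qed.

Definition eis_coprime z w := exists u v, u * z + v * w = 1.

Lemma eis_coprime_sym z w : eis_coprime z w -> eis_coprime w z.
Proof. by case=> u [v E]; exists v, u; rewrite addrC. Qed.

Lemma eis_coprime_ndvd pi z w : eis_prime pi ->
  eis_coprime z w -> eis_dvd pi w -> ~ eis_dvd pi z.
Proof.
case=> _ p1 _ [u [v E]] pw pz; apply: (p1); have : eis_dvd pi (u * z + v * w).
  by apply: eis_dvdD; apply: eis_dvd_mull.
by rewrite E.
Qed.

Lemma coprimez_eis (m n : int) : coprimez m n -> eis_coprime m%:~R n%:~R.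
Proof.
case/coprimezP => -[u v] /= E; exists u%:~R, v%:~R.
by rewrite -!intrM -intrD E.
Qed.

Lemma eis_coprime_norm z (n : int) :
  coprimez (eis_norm z) n -> eis_coprime z n%:~R.
Proof.
case/coprimez_eis=> u [v]; rewrite eis_normE => E.
by exists (u * eis_conj z), v; rewrite -[RHS]E; ring.
Qed.

(** * The cubic Jacobi symbol *)

Lemma primary_factorization_dvd beta s pi :
  primary_factorization beta s -> pi \in s -> eis_dvd pi beta.
Proof.
case=> _ Es pis; have ps := perm_to_rem pis.
have ds : eis_dvd pi (\prod_(x <- s) x).
  by rewrite (perm_big _ ps) big_cons; apply: eis_dvd_mulr; apply: eis_dvdxx.
by case: Es => ->; last apply: eis_dvdN.
Qed.

(** By uniqueness of the factorization the one picked in the definition is a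
    permutation of any other. *)
Lemma cubic_jacobiE alpha beta s : primary_factorization beta s ->
  cubic_jacobi alpha beta = \prod_(pi <- s) cubic_symbol alpha pi.
Proof.
move=> [hs Es]; rewrite /cubic_jacobi; case: xgetP => [s' _ [hs' Es']|/(_ s) []//].
apply: perm_big; apply: primary_primes_uniq => //.
case: Es Es' => -> [] E; [left | right | right | left] => //.
- by rewrite E opprK.
- exact: oppr_inj.
Qed.

Section Jacobi.
Variable beta : eisenstein.
Hypothesis hbeta : primary_up_to_sign beta.

Lemma cubic_jacobiM alpha alpha' : cubic_jacobi (alpha * alpha') beta =
  cubic_jacobi alpha beta * cubic_jacobi alpha' beta.
Proof.
have [s hs] := primary_factorization_exists hbeta.
rewrite !(cubic_jacobiE _ hs) -big_split; apply: eq_big_seq => pi pis.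
by have [/(_ _ pis) [Pp Qp] _] := hs; apply: cubic_symbolM.
Qed.

Lemma cubic_jacobi_congr alpha alpha' : eis_dvd beta (alpha - alpha') ->
  cubic_jacobi alpha beta = cubic_jacobi alpha' beta.
Proof.
have [s hs] := primary_factorization_exists hbeta => hd.
rewrite !(cubic_jacobiE _ hs); apply: eq_big_seq => pi pis.
have [/(_ _ pis) [Pp Qp] _] := hs; apply: cubic_symbol_congr => //.
exact: (eis_dvd_trans (primary_factorization_dvd hs pis) hd).
Qed.

Lemma cubic_jacobi_values alpha : cubic_jacobi alpha beta \in cubic_values.
Proof.
have [s hs] := primary_factorization_exists hbeta.
rewrite (cubic_jacobiE _ hs) big_seq; apply: (big_ind (fun x => x \in cubic_values)) => //.
  exact: cubic_valuesM.
by move=> pi /(proj1 hs) [Pp Qp]; case: (cubic_symbolP alpha Pp Qp).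
Qed.

Lemma cubic_jacobi_neq0 alpha :
  eis_coprime alpha beta -> cubic_jacobi alpha beta != 0.
Proof.
have [s hs] := primary_factorization_exists hbeta => hco.
rewrite (cubic_jacobiE _ hs) big_seq; apply: (big_ind (fun x => x != 0)) => //.
  by move=> x y /eqP x0 /eqP y0; apply/eqP => /eis_mulf_eq0 [].
move=> pi pis; have [Pp Qp] := proj1 hs _ pis; apply/eqP.
move/(cubic_symbol_eq0 _ Pp Qp).
exact: eis_coprime_ndvd hco (primary_factorization_dvd hs pis).
Qed.

Lemma cubic_jacobi_cube alpha :
  eis_coprime alpha beta -> cubic_jacobi alpha beta ^+ 3 = 1.
Proof.
move/cubic_jacobi_neq0; apply: cubic_values_cube; exact: cubic_jacobi_values.
Qed.

Lemma cubic_jacobi1 : cubic_jacobi 1 beta = 1.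
Proof.
have [s hs] := primary_factorization_exists hbeta.
rewrite (cubic_jacobiE _ hs) big_seq big1 // => pi /(proj1 hs) [Pp Qp].
exact: cubic_symbol1.
Qed.

Lemma cubic_jacobiX alpha n :
  cubic_jacobi (alpha ^+ n) beta = cubic_jacobi alpha beta ^+ n.
Proof.
elim: n => [|n IHn]; first by rewrite !expr0 cubic_jacobi1.
by rewrite !exprS cubic_jacobiM IHn.
Qed.

Lemma cubic_jacobiN alpha :
  cubic_jacobi (- alpha) beta = cubic_jacobi alpha beta.
Proof.
rewrite -[alpha in LHS]mul1r -mulNr cubic_jacobiM.
have -> : -1 = (-1) ^+ 3 :> eisenstein by ring.
rewrite cubic_jacobiX cubic_jacobi_cube ?mul1r //.
by exists (-1), 0; ring.
Qed.

End Jacobi.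

Lemma primary_up_to_sign_int (n : int) : ~~ (3 %| n)%Z -> primary_up_to_sign n%:~R.
Proof. by move=> n3; rewrite /primary_up_to_sign ere_int eom_int dvdz0 n3. Qed.

Lemma cubic_jacobi_mulr alpha beta beta' : primary_up_to_sign beta ->
  primary_up_to_sign beta' ->
  cubic_jacobi alpha (beta * beta') =
  cubic_jacobi alpha beta * cubic_jacobi alpha beta'.
Proof.
move=> /primary_factorization_exists [s hs] /primary_factorization_exists [s' hs'].
rewrite (cubic_jacobiE _ hs) (cubic_jacobiE _ hs') -big_cat.
apply: cubic_jacobiE; split=> [pi|].
  by rewrite mem_cat => /orP[/(proj1 hs)|/(proj1 hs')].
rewrite big_cat; case: hs hs' => _ [] -> [_ [] ->]; [left|right|right|left];
  by rewrite ?mulrN ?mulNr ?opprK.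
Qed.

Lemma cubic_jacobi_conj alpha beta : primary_up_to_sign beta ->
  cubic_jacobi (eis_conj alpha) (eis_conj beta) =
  eis_conj (cubic_jacobi alpha beta).
Proof.
move=> /primary_factorization_exists [s hs].
rewrite (cubic_jacobiE _ hs) (@cubic_jacobiE _ _ (map eis_conj s)).
  rewrite big_map rmorph_prod; apply: eq_big_seq => pi /(proj1 hs) [Pp Qp].
  exact: cubic_symbol_conj.
split=> [pi /mapP[x /(proj1 hs) [Pp Qp] ->]|].
  by split; [apply: eis_conj_prime | apply: eis_conj_primary].
by rewrite big_map -rmorph_prod; case: hs => _ [] ->; [left | right; rewrite rmorphN].
Qed.

Lemma eis_conj_int (n : int) : eis_conj n%:~R = n%:~R.
Proof. exact: rmorph_int. Qed.

(** Conjugation fixes both arguments, and 1 is the only cube root of unity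
    fixed by conjugation. *)
Lemma cubic_jacobi_int (m n : int) : ~~ (3 %| n)%Z -> eis_coprime m%:~R n%:~R ->
  cubic_jacobi m%:~R n%:~R = 1.
Proof.
move=> /primary_up_to_sign_int n3 co; have := cubic_jacobi_conj m%:~R n3.
rewrite !eis_conj_int; have := cubic_jacobi_values n3 m%:~R.
have := cubic_jacobi_neq0 n3 co; move: (cubic_jacobi _ _) => x x0.
by rewrite !inE (negbTE x0) /= => /or3P[] /eqP-> // /eqP.
Qed.

(** * Cubic characters and Jacobi sums *)

Section CubicCharacter.
Variables (pi : eisenstein) (p : nat).
Hypotheses (Pp : eis_prime pi) (Qp : eis_primary pi).
Hypotheses (p_pr : prime p) (Np : eis_norm pi = p).

Let p_gt0 := prime_gt0 p_pr.

Lemma primary_prime_norm_mod3 : (p %% 3 = 1)%N.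
Proof. by have := primary_norm_mod3 Qp; rewrite Np; have := p_gt0; lia. Qed.

Lemma eis_rmorph_Fp : exists f : {rmorphism eisenstein -> 'F_p}, f pi = 0.
Proof.
have := primary_prime_norm_mod3 => p1.
have [|w Ew] := @finField_cube_root 'F_p.
  by rewrite card_Fp //; have := p_gt0; move: p1; lia.
apply: (eis_rmorphism_killing (k := 1) Ew (pchar_Fp p_pr)) => //.
Qed.

(** The argument [t] is read as its representative between 0 and [p - 1]. *)
Definition cubic_char (t : 'F_p) : eisenstein := cubic_symbol (t : nat)%:R pi.
Local Notation chi := cubic_char.

Lemma natr_FpK (t : 'F_p) : (t : nat)%:R = t :> 'F_p.
Proof. exact: natr_Zp. Qed.

Lemma eis_dvd_Fp (rho : {rmorphism eisenstein -> 'F_p}) m n : rho pi = 0 ->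
  m%:R = n%:R :> 'F_p -> eis_dvd pi (m%:R - n%:R).
Proof.
move=> rho0 E; apply/(eis_rmorph_ker _ Pp rho0).
by rewrite rmorphB !rmorph_nat E subrr.
Qed.

Lemma cubic_char_nat (n : nat) : chi n%:R = cubic_symbol n%:R pi.
Proof.
have [rho rho0] := eis_rmorph_Fp.
by apply: cubic_symbol_congr => //; apply: (eis_dvd_Fp rho0); rewrite natr_FpK.
Qed.

Lemma cubic_charM s t : chi (s * t) = chi s * chi t.
Proof.
by rewrite -cubic_symbolM // -natrM -cubic_char_nat natrM !natr_FpK.
Qed.

Lemma cubic_char1 : chi 1 = 1.
Proof. by rewrite -[1 in LHS]/(1%:R) cubic_char_nat cubic_symbol1. Qed.

Lemma cubic_char_eq0 t : (chi t == 0) = (t == 0).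
Proof.
have [rho rho0] := eis_rmorph_Fp.
apply/eqP/eqP => [/(cubic_symbol_eq0 _ Pp Qp)|->].
  by move/(eis_rmorph_ker _ Pp rho0); rewrite rmorph_nat natr_FpK.
by apply/(cubic_symbol_eq0 _ Pp Qp); apply: eis_dvd0.
Qed.

Lemma cubic_char0 : chi 0 = 0.
Proof. by apply/eqP; rewrite cubic_char_eq0. Qed.

Lemma cubic_char_values t : chi t \in cubic_values.
Proof. by case: (cubic_symbolP (t : nat)%:R Pp Qp). Qed.

Lemma cubic_char_cube t : t != 0 -> chi t ^+ 3 = 1.
Proof.
by rewrite -cubic_char_eq0; apply: cubic_values_cube; apply: cubic_char_values.
Qed.

Lemma cubic_charN t : chi (- t) = chi t.
Proof.
have -> : - t = (-1) ^+ 3 * t by ring.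
rewrite !exprS expr0 !cubic_charM cubic_char1.
have := @cubic_char_cube (-1); rewrite oppr_eq0 oner_eq0 => /(_ isT).
by rewrite !exprS expr0 => ->; rewrite mul1r.
Qed.

Lemma cubic_char_conj t : eis_conj (chi t) = chi t ^+ 2.
Proof. by have := cubic_char_values t; rewrite !inE => /or4P[] /eqP->; apply/eqP. Qed.

Let e := (p.-1 %/ 3)%N.

Lemma rmorph_cubic_char (rho : {rmorphism eisenstein -> 'F_p}) t :
  rho pi = 0 -> rho (chi t) = t ^+ e.
Proof.
move=> rho0; have [_ /(eis_rmorph_ker _ Pp rho0) /eqP] :=
  cubic_symbolP (t : nat)%:R Pp Qp.
rewrite rmorphB rmorphXn rmorph_nat natr_FpK subr_eq0 => /eqP <-.
by rewrite /cubic_exponent Np.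
Qed.

(** Otherwise ['X^k - 1] would have [p - 1] roots, more than its degree. *)
Lemma expr_neq1_Fp k : (0 < k < p.-1)%N -> exists2 t : 'F_p, t != 0 & t ^+ k != 1.
Proof.
case/andP=> k0 kp; apply: contrapT => no.
have : (#|predC1 (0%R : 'F_p)| < size ('X^k - 1%:P : {poly 'F_p})%R)%N.
  rewrite cardE; apply: max_poly_roots; rewrite ?enum_uniq //.
    by rewrite -size_poly_eq0 size_XnsubC.
  apply/allP => x; rewrite mem_enum inE => x0; rewrite rootE !hornerE.
  by apply/eqP; apply: contrapT => /eqP; rewrite subr_eq0 => hx; apply: no; exists x.
by rewrite size_XnsubC // cardC1 card_Fp // ltnS leqNgt kp.
Qed.

Lemma sum_expr_Fp k : (k < p.-1)%N -> \sum_(t : 'F_p) t ^+ k = 0.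
Proof.
move=> kp; have [->|k0] := posnP k.
  rewrite (eq_bigr (fun=> 1)) => [|t _]; last by rewrite expr0.
  by rewrite sumr_const card_Fp // pchar_Fp_0.
have [|u u0 uk] := @expr_neq1_Fp k; first by rewrite k0.
have : (u ^+ k - 1) * \sum_(t : 'F_p) t ^+ k = 0.
  rewrite mulrBl mul1r [X in _ - X](reindex_inj (mulfI u0)) /= mulr_sumr.
  by rewrite -sumrB big1 // => t _; rewrite exprMn subrr.
by move/eqP; rewrite mulf_eq0 subr_eq0 (negbTE uk) => /eqP.
Qed.

Lemma sum_poly_Fp (P : {poly 'F_p}) : (size P <= p.-1)%N ->
  \sum_(t : 'F_p) P.[t] = 0.
Proof.
move=> sP; under eq_bigr do rewrite horner_coef.
rewrite exchange_big big1 //= => i _; rewrite -mulr_sumr sum_expr_Fp ?mulr0 //.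
exact: leq_trans (ltn_ord i) sP.
Qed.

Lemma sum_cubic_char : \sum_t chi t = 0.
Proof.
have [rho rho0] := eis_rmorph_Fp.
have [|u u0 ue] := @expr_neq1_Fp e.
  have := primary_prime_norm_mod3; have := prime_gt1 p_pr; rewrite /e; lia.
have : (chi u - 1) * \sum_t chi t = 0.
  rewrite mulrBl mul1r [X in _ - X](reindex_inj (mulfI u0)) /= mulr_sumr.
  by rewrite -sumrB big1 // => t _; rewrite cubic_charM subrr.
case/eis_mulf_eq0=> // /eqP; rewrite subr_eq0 => /eqP chi1.
by move: ue; rewrite -(rmorph_cubic_char u rho0) chi1 rmorph1 eqxx.
Qed.

Lemma sum_cubic_char2 : \sum_t chi t ^+ 2 = 0.
Proof.
under eq_bigr do rewrite -cubic_char_conj.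
by rewrite -rmorph_sum sum_cubic_char rmorph0.
Qed.

Definition jacobi_sum : eisenstein := \sum_t chi t * chi (1 - t).
Local Notation J := jacobi_sum.

Lemma convolution_scale (a b : 'F_p -> eisenstein) (w : 'F_p) :
  {morph a : s t / s * t} -> {morph b : s t / s * t} -> w != 0 ->
  \sum_s a s * b (w - s) = a w * b w * \sum_s a s * b (1 - s).
Proof.
move=> aM bM w0; rewrite (reindex_inj (mulfI w0)) /= mulr_sumr.
apply: eq_bigr => s _; have -> : w - w * s = w * (1 - s) by ring.
by rewrite aM bM; ring.
Qed.

Lemma convolution_chi_chi (w : 'F_p) : \sum_s chi s * chi (w - s) = J * chi w ^+ 2.
Proof.
have [->|w0] := eqVneq w 0; last first.
  by rewrite (convolution_scale cubic_charM cubic_charM w0) mulrC.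
rewrite cubic_char0 expr0n mulr0 -[RHS]sum_cubic_char2.
by apply: eq_bigr => s _; rewrite sub0r cubic_charN.
Qed.

Lemma convolution_chi_chi2_0 : \sum_s chi s * chi (0 - s) ^+ 2 = p.-1%:R.
Proof.
rewrite (bigD1 0) //= cubic_char0 mul0r add0r.
rewrite (eq_bigr (fun=> 1)) => [|s s0]; last first.
  by rewrite sub0r cubic_charN -exprS cubic_char_cube.
by rewrite sumr_const cardC1 card_Fp.
Qed.

Lemma cubic_char2M : {morph (fun t => chi t ^+ 2) : s t / s * t}.
Proof. by move=> s t; rewrite /= cubic_charM exprMn. Qed.

(** The convolution is constant on nonzero points, and its total is the
    product of the sums of [chi] and of its square, which vanish; its value at
    0 is [p - 1]. *)
Lemma convolution_chi_chi2 (w : 'F_p) : w != 0 -> \sum_s chi s * chi (w - s) ^+ 2 = -1.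
Proof.
set K := \sum_s chi s * chi (1 - s) ^+ 2.
have hK x : x != 0 -> \sum_s chi s * chi (x - s) ^+ 2 = K.
  move=> x0; rewrite (convolution_scale cubic_charM cubic_char2M x0).
  by rewrite -exprS cubic_char_cube // mul1r.
move=> w0; rewrite hK //.
have : \sum_x \sum_s chi s * chi (x - s) ^+ 2 = 0.
  transitivity ((\sum_t chi t) * \sum_t chi t ^+ 2); last by rewrite sum_cubic_char mul0r.
  rewrite exchange_big /= mulr_suml.
  apply: eq_bigr => s _; rewrite -mulr_sumr; congr (_ * _).
  by rewrite [RHS](reindex_inj (addIr (- s))).
rewrite (bigD1 0) //= convolution_chi_chi2_0 (eq_bigr (fun=> K)) => [|x /hK //].
rewrite sumr_const cardC1 card_Fp // -[K *+ _]mulr_natl -{1}[p.-1%:R]mulr1 -mulrDr.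
case/eis_mulf_eq0 => [/(congr1 ere)|/eqP].
  by rewrite ere_nat /=; have := prime_gt1 p_pr; lia.
by rewrite addrC addr_eq0 => /eqP.
Qed.

(** For nonzero [s] and [t] the product [(chi s - 1) * (chi t - 1)] is a
    multiple of the square of [1 - omega], hence of 3. Summing over
    [s + t = 1] gives the class of the Jacobi sum modulo 3. *)
Lemma jacobi_sum_mod3 : eis_dvd 3 (J + p%:R).
Proof.
have h s t : eis_dvd 3 (chi s * chi t - chi s * (t != 0)%:R - chi t * (s != 0)%:R
    + (s != 0)%:R * (t != 0)%:R).
  rewrite -!cubic_char_eq0; have := cubic_char_values s; have := cubic_char_values t.
  rewrite !inE.
  case/or4P=> /eqP-> /or4P[] /eqP->; solve [exists 0; exact/eqP
    | exists 1; exact/eqP | exists (- omega); exact/eqP | exists (1 + omega); exact/eqP].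
have E11 : (1 - 1 != 0 :> 'F_p)%:R = 0 :> eisenstein by rewrite subrr eqxx.
have E00 : (0 != 0 :> 'F_p)%:R = 0 :> eisenstein by rewrite eqxx.
have S1 : \sum_s chi s * (1 - s != 0)%:R = -1.
  rewrite (bigD1 1) // E11 mulr0 /= add0r; apply/eqP; rewrite -addr_eq0 addrC.
  rewrite -{1}cubic_char1 -[X in _ == X]sum_cubic_char [X in _ == X](bigD1 1) //=.
  apply/eqP; congr (_ + _); apply: eq_bigr => s s1.
  by rewrite subr_eq0 eq_sym s1 mulr1.
have S2 : \sum_s chi (1 - s) * (s != 0)%:R = -1.
  rewrite -S1 (reindex_inj (inv_inj (subKr (1 : 'F_p)))) /=.
  by apply: eq_bigr => s _; rewrite subKr.
have S3 : \sum_(s : 'F_p) (s != 0)%:R * (1 - s != 0)%:R = p%:R - 2 :> eisenstein.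
  rewrite (bigD1 0) // E00 mul0r /= add0r (bigD1 1) ?oner_eq0 // E11 mulr0 /= add0r.
  rewrite (eq_bigr (fun=> 1)) => [|s /andP[s0 s1]]; last first.
    by rewrite s0 subr_eq0 eq_sym s1 mulr1.
  rewrite sumr_const.
  have := cardC (pred2 (0 : 'F_p) 1); rewrite card2 eq_sym oner_eq0 card_Fp //.
  move/(congr1 (fun n => n%:R : eisenstein)) => <-; rewrite natrD addrC addKr; congr (_ *+ _).
  by apply: eq_card => s; rewrite !inE negb_or.
have -> : J + p%:R = \sum_s (chi s * chi (1 - s) - chi s * (1 - s != 0)%:R
    - chi (1 - s) * (s != 0)%:R + (s != 0)%:R * (1 - s != 0)%:R).
  by rewrite big_split sumrB sumrB /= S1 S2 S3 -/J; ring.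
by apply: (big_ind (eis_dvd 3)) => // [|x y]; [apply: eis_dvd0 | apply: eis_dvdD].
Qed.

Lemma jacobi_sum_primary : eis_primary J.
Proof.
have [k Ek] := jacobi_sum_mod3; have := primary_prime_norm_mod3.
have := congr1 ere Ek; have := congr1 eom Ek; rewrite /eis_primary !eisE; lia.
Qed.

(** Modulo [pi] the character is the power map of exponent [(p - 1) / 3], so
    the Jacobi sum becomes the sum over [F_p] of the values of a polynomial of
    degree less than [p - 1]. *)
Lemma jacobi_sum_dvd : eis_dvd pi J.
Proof.
have [rho rho0] := eis_rmorph_Fp; apply/(eis_rmorph_ker _ Pp rho0).
rewrite rmorph_sum -[RHS](@sum_poly_Fp ('X^e * (1 - 'X) ^+ e)).
  apply: eq_bigr => t _.
  by rewrite rmorphM !rmorph_cubic_char // hornerM hornerXn horner_exp !hornerE.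
have s2 : size (1 - 'X : {poly 'F_p}) = 2%N.
  by rewrite -opprB size_polyN size_XsubC.
have s0 : (1 - 'X : {poly 'F_p}) != 0 by rewrite -size_poly_gt0 s2.
rewrite size_mul ?expf_neq0 ?polyX_eq0 // size_polyXn.
apply: (@leq_trans (e.+1 + (1 * e).+1).-1).
  rewrite -!subn1 leq_sub2r // leq_add2l.
  by have := size_poly_exp_leq (1 - 'X : {poly 'F_p}) e; rewrite s2.
have := primary_prime_norm_mod3; have := prime_gt1 p_pr; rewrite /e; lia.
Qed.

End CubicCharacter.

(** * Gauss sums in finite fields *)

(** The exponent [2 * (p - 1)] makes the number of nonzero elements divisible
    by [p] and by 3, by Fermat. *)
Lemma finField_with_roots (p q : nat) : prime p -> prime q -> q != p -> q != 3%N ->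
  exists F : finFieldType, [/\ q \in [pchar F],
    exists w : F, w ^+ 2 + w + 1 = 0 & exists zeta : F, p.-primitive_root zeta].
Proof.
move=> p_pr q_pr qp q3; have p1 := prime_gt1 p_pr.
have k0 : (0 < 2 * p.-1)%N by case: p p1 {p_pr qp} => [|[|]].
have [F qF cF] := pPrimePowerField q_pr k0.
have dvd r : prime r -> q != r -> (r.-1 %| 2 * p.-1)%N -> (r %| #|F|.-1)%N.
  move=> r_pr qr /dvdnP [l El]; rewrite cF -subn1 -eqn_mod_dvd ?expn_gt0 ?prime_gt0 //.
  have co : coprime q r by rewrite prime_coprime // dvdn_prime2.
  rewrite El mulnC expnM -modnXm -(totient_prime r_pr) Euler_exp_totient //.
  by rewrite modnXm exp1n.
exists F; split=> //; last by apply: finField_primitive_root; apply: dvd => //; exact: dvdn_mull.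
by apply: finField_cube_root; apply: dvd => //; exact: dvdn_mulr.
Qed.

Section GaussSum.
Variables (pi : eisenstein) (p : nat).
Hypotheses (Pp : eis_prime pi) (Qp : eis_primary pi).
Hypotheses (p_pr : prime p) (Np : eis_norm pi = p).
Local Notation chi := (@cubic_char pi p).
Local Notation J := (jacobi_sum pi p).

Variables (F : finFieldType) (f : {rmorphism eisenstein -> F}) (zeta : F).
Hypothesis zetaP : p.-primitive_root zeta.

Lemma p_neq0 : p%:R != 0 :> F.
Proof. exact: (prim_root_natf_neq0 (R := F) zetaP). Qed.

Definition additive_char (t : 'F_p) := zeta ^+ t.
Local Notation psi := additive_char.

Lemma additive_char_nat n : psi n%:R = zeta ^+ n.
Proof. by rewrite /psi -[in RHS](prim_expr_mod zetaP) val_Fp_nat. Qed.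

Lemma additive_charD s t : psi (s + t) = psi s * psi t.
Proof.
by rewrite -[s in LHS]natr_FpK -[t in LHS]natr_FpK -natrD additive_char_nat exprD.
Qed.

Lemma sum_additive_char : \sum_t psi t = 0.
Proof.
have z1 : zeta - 1 != 0.
  rewrite subr_eq0 -[zeta]expr1 -(prim_order_dvd zetaP) dvdn1.
  by rewrite gtn_eqF ?prime_gt1.
apply: (mulfI z1); rewrite mulr0 mulrBl mul1r mulr_sumr.
rewrite [X in _ - X](reindex_inj (addrI 1)) /= -sumrB big1 // => t _.
by rewrite additive_charD -[1]/(1%:R) additive_char_nat expr1 subrr.
Qed.

Definition gauss_sum (c : 'F_p -> eisenstein) := \sum_t f (c t) * psi t.

Lemma gauss_sumM (a b : 'F_p -> eisenstein) :
  gauss_sum a * gauss_sum b =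
  gauss_sum (fun x => \sum_s a s * b (x - s)).
Proof.
rewrite /gauss_sum mulr_suml.
transitivity (\sum_s \sum_x f (a s * b (x - s)) * psi x).
  apply: eq_bigr => s _; rewrite mulr_sumr [RHS](reindex_inj (addIr s)) /=.
  apply: eq_bigr => t _; rewrite addrK additive_charD rmorphM; ring.
rewrite exchange_big /=; apply: eq_bigr => x _.
by rewrite rmorph_sum mulr_suml.
Qed.

Local Notation g := (gauss_sum chi).
Local Notation g2 := (gauss_sum (fun t => chi t ^+ 2)).

Lemma gauss_sum_sq : g * g = f J * g2.
Proof.
rewrite gauss_sumM /gauss_sum mulr_sumr; apply: eq_bigr => t _.
by rewrite convolution_chi_chi // rmorphM mulrA.
Qed.

Lemma gauss_sum_sq2 : g2 * g2 = f (eis_conj J) * g.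
Proof.
rewrite gauss_sumM /gauss_sum mulr_sumr; apply: eq_bigr => t _.
under eq_bigr do rewrite -!cubic_char_conj // -rmorphM.
rewrite -rmorph_sum convolution_chi_chi //=.
have -> : eis_conj (J * chi t ^+ 2) = eis_conj J * chi t.
  rewrite rmorphM rmorphXn /= cubic_char_conj // -exprM.
  have [->|t0] := eqVneq t 0; first by rewrite cubic_char0 // expr0n.
  by rewrite exprS cubic_char_cube // mulr1.
by rewrite rmorphM mulrA.
Qed.

Lemma gauss_sumN : g * g2 = p%:R.
Proof.
rewrite gauss_sumM /gauss_sum (bigD1 0) //= convolution_chi_chi2_0 //.
rewrite (eq_bigr (fun x => - psi x)) => [|t t0]; last first.
  by rewrite convolution_chi_chi2 // rmorphN1 mulN1r.
rewrite sumrN rmorph_nat {1}/psi expr0 mulr1.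
have := sum_additive_char; rewrite (bigD1 0) //= {1}/psi expr0 => /eqP.
rewrite addrC addr_eq0 => /eqP ->; rewrite opprK -mulrSr prednK //.
exact: prime_gt0.
Qed.

Lemma gauss_sum_cube : g ^+ 3 = f J * p%:R.
Proof. by rewrite exprS expr2 gauss_sum_sq mulrCA gauss_sumN. Qed.

(** Multiply the expressions of the squares of the two conjugate Gauss sums,
    whose product is [p]. *)
Lemma jacobi_sum_norm_rmorph : f (eis_norm J)%:~R = p%:R.
Proof.
have E : p%:R * p%:R = f (eis_norm J)%:~R * p%:R :> F.
  rewrite -{1 2}gauss_sumN mulrACA gauss_sum_sq gauss_sum_sq2 eis_normE rmorphM.
  by rewrite -gauss_sumN; ring.
by apply: (mulIf p_neq0); rewrite -E.
Qed.

(** This power of the Frobenius map fixes the values of [chi] and multiplies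
    the exponents of [zeta] by [q ^ k]; a change of variable in the sum brings
    them back. *)
Lemma gauss_sum_Frobenius (q k : nat) : q \in [pchar F] -> (q ^ k %% 3 = 1)%N ->
  f (chi (q ^ k)%:R) * g ^+ (q ^ k) = g.
Proof.
move=> qF qk1; have q_pr := pcharf_prime qF.
have -> : g ^+ (q ^ k) = \sum_t f (chi t) * psi (t * (q ^ k)%:R).
  rewrite /gauss_sum (big_morph (fun x : F => x ^+ (q ^ k))
     (id1 := 0) (op1 := +%R)) => [|x y|]; last first.
  - by rewrite expr0n gtn_eqF ?expn_gt0 ?prime_gt0.
  - by rewrite exprDn_pchar // pnatX pnatE ?qF.
  apply: eq_bigr => t _; rewrite exprMn (eis_rmorph_Frobenius _ _ qF) //.
  congr (_ * _); rewrite -[t in RHS]natr_FpK -natrM additive_char_nat.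
  by rewrite /psi -exprM.
have qk0 : (q ^ k)%:R != 0 :> 'F_p.
  rewrite -(dvdn_pcharf (pchar_Fp p_pr)); apply/negP.
  case: k {qk1} => [|k]; first by rewrite expn0 dvdn1 gtn_eqF ?prime_gt1.
  move=> h; have := p_neq0; rewrite -(dvdn_pcharf qF) dvdn_prime2 //.
  by move: h; rewrite Euclid_dvdX // andbT dvdn_prime2 // eq_sym => ->.
rewrite mulr_sumr [RHS](reindex_inj (mulIf qk0)) /=.
by apply: eq_bigr => t _; rewrite mulrA -rmorphM -cubic_charM // [_%:R * t]mulrC.
Qed.

End GaussSum.

(** The norm of the Jacobi sum equals [p] in finite fields of arbitrarily large
    characteristic, hence in the integers. The sum is thus associated to
    [pi], and both are primary. *)
Lemma jacobi_sum_eq pi p : eis_prime pi -> eis_primary pi -> prime p ->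
  eis_norm pi = p -> jacobi_sum pi p = pi.
Proof.
move=> Pp Qp p_pr Np; set J := jacobi_sum pi p.
have NJ : eis_norm J = p.
  (* Such a q exceeds the difference of the two integers, and differs from p and 3. *)
  have [q q_gt q_pr] := prime_above (`|eis_norm J| + p + 3)%N.
  have [||F [qF [w Ew] [zeta zetaP]]] := @finField_with_roots p q p_pr q_pr.
  - by apply: contraTneq q_gt => ->; lia.
  - by apply: contraTneq q_gt => ->; lia.
  have [f _] := eis_rmorphism Ew.
  have := jacobi_sum_norm_rmorph Pp Qp p_pr Np f zetaP.
  rewrite rmorph_int -/J; have N0 := eis_norm_ge0 J.
  rewrite -(gez0_abs N0) -pmulrn; move: (`|eis_norm J|%N) q_gt => m q_gt /eqP.
  have h a b : (a <= b)%N -> (b < q)%N -> a%:R == b%:R :> F -> a = b.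
    move=> ab bq; rewrite eq_sym -subr_eq0 -natrB // -(dvdn_pcharf qF).
    by case: (posnP (b - a)) => [|h /dvdn_leq]; lia.
  case: (leqP m p) => [mp|/ltnW mp]; last rewrite eq_sym.
    by move/h => -> //; lia.
  by move/h => -> //; lia.
have [k Ek] := jacobi_sum_dvd Pp Qp p_pr Np.
have Qj := jacobi_sum_primary Pp Qp p_pr Np.
have Nk : eis_norm k = 1.
  have := congr1 eis_norm Ek; rewrite eis_normM -/J NJ Np => E.
  have p0 : (p : int) != 0 by have := prime_gt0 p_pr; lia.
  by apply: (mulIf p0); rewrite mul1r -E.
rewrite -/J in Ek Qj; rewrite Ek in Qj.
by rewrite Ek (primary_associate_eq Nk Qp Qj) mul1r.
Qed.

(** The cube of the Gauss sum of [pi] is [p * pi], so its power of exponent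
    [N(pi2) - 1] is the symbol of [p * pi] over [pi2]; by the Frobenius map it
    is also the inverse of the symbol of [N(pi2)] over [pi]. *)
Lemma cubic_symbol_Gauss pi p pi2 q k : eis_prime pi -> eis_primary pi ->
  prime p -> eis_norm pi = p ->
  eis_prime pi2 -> eis_primary pi2 -> prime q -> q != 3%N -> q != p ->
  (0 < k)%N -> eis_norm pi2 = (q ^ k)%N ->
  cubic_symbol (p%:R * pi) pi2 * cubic_symbol (eis_norm pi2)%:~R pi = 1.
Proof.
move=> Pp Qp p_pr Np P2 Q2 q_pr q3 qp k0 N2.
have [F [qF [w Ew] [zeta zetaP]]] := finField_with_roots p_pr q_pr qp q3.
have [f f0] := eis_rmorphism_killing Ew qF k0 N2.
have [e0 EN] := cubic_exponentP P2 Q2; set e := cubic_exponent pi2 in e0 EN.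
have EqN : (q ^ k = (e * 3).+1)%N by rewrite -EN N2.
have qk1 : (q ^ k %% 3 = 1)%N by rewrite EqN; lia.
set g := gauss_sum f zeta (@cubic_char pi p).
have g3 : g ^+ 3 = f (p%:R * pi).
  rewrite (gauss_sum_cube Pp Qp p_pr Np f zetaP) jacobi_sum_eq //.
  by rewrite rmorphM rmorph_nat mulrC.
have g0 : g != 0.
  apply/eqP => g0; have := gauss_sumN Pp Qp p_pr Np f zetaP; rewrite -/g g0 mul0r.
  by move/esym/eqP; rewrite (negbTE (p_neq0 zetaP)).
have := gauss_sum_Frobenius Pp Qp p_pr Np f zetaP qF qk1.
rewrite -/g EqN exprS mulrCA -[RHS]mulr1 => /(mulfI g0).
rewrite -EqN [(e * 3)%N]mulnC exprM g3 -rmorphXn -rmorphM cubic_char_nat // => fE.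
have [h1 d1] := cubic_symbolP (p%:R * pi) P2 Q2.
have [h2 _] := cubic_symbolP (q ^ k)%:R Pp Qp.
rewrite N2 -pmulrn; apply: (cubic_values_inj P2 Q2) => //.
  exact: cubic_valuesM.
apply/(eis_rmorph_ker _ P2 f0); rewrite rmorphB rmorph1 rmorphM.
move/(eis_rmorph_ker _ P2 f0): d1; rewrite rmorphB => /eqP; rewrite subr_eq0 -/e.
move/eqP => <-; rewrite -rmorphM mulrC fE; exact: subrr.
Qed.

(** * Reciprocity with a rational argument *)

Lemma eis_norm_prod (s : seq eisenstein) :
  eis_norm (\prod_(x <- s) x) = \prod_(x <- s) eis_norm x.
Proof. by apply: (big_morph eis_norm eis_normM eis_norm1). Qed.

Lemma primary_prime_factorization pi : eis_prime pi -> eis_primary pi ->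
  primary_factorization pi [:: pi].
Proof.
move=> Pp Qp; split=> [x|]; last by left; rewrite big_seq1.
by rewrite inE => /eqP ->.
Qed.

Lemma eis_prime_coprime pi z : eis_prime pi -> ~ eis_dvd pi z -> eis_coprime pi z.
Proof. by move=> Pp; case: (eis_prime_bezout z Pp). Qed.

(** Multiply [cubic_symbol_Gauss] over the primes dividing [n]. The norms
    multiply to [n ^ 2], and the symbol of [p] over [n] is 1. *)
Lemma cubic_reciprocity_prime pi p (n : int) : eis_prime pi -> eis_primary pi ->
  prime p -> eis_norm pi = p -> ~~ (3 %| n)%Z -> ~~ (p %| n)%Z ->
  cubic_jacobi pi n%:~R = cubic_symbol n%:~R pi.
Proof.
move=> Pp Qp p_pr Np n3 pn; have hn := primary_up_to_sign_int n3.
have [s hs] := primary_factorization_exists hn.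
have EN : n ^+ 2 = \prod_(x <- s) eis_norm x.
  rewrite -eis_norm_prod -eis_norm_int; case: hs => _ [] -> //.
  by rewrite eis_normN.
have : cubic_jacobi (p%:R * pi) n%:~R * cubic_symbol (n ^+ 2)%:~R pi = 1.
  rewrite (cubic_jacobiE _ hs) EN.
  have -> : cubic_symbol (\prod_(x <- s) eis_norm x)%:~R pi =
      \prod_(x <- s) cubic_symbol (eis_norm x)%:~R pi.
    apply: (big_morph (fun m : int => cubic_symbol m%:~R pi)) => [a b|].
      by rewrite intrM cubic_symbolM.
    exact: cubic_symbol1.
  rewrite -big_split big_seq big1 //= => x xs.
  have [Px Qx] := proj1 hs x xs.
  have [q [k [q_pr q3 _ Nx _]]] := primary_prime_classify Px Qx.
  have k0 : (0 < k)%N.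
    have [_ p1 _] := Px; rewrite lt0n; apply: contra_not_neq p1 => k0.
    by apply/eis_dvd1; rewrite Nx k0.
  apply: (@cubic_symbol_Gauss pi p x q k) => //; apply: contra pn => /eqP <-.
  have := eis_dvd_norm (primary_factorization_dvd hs xs).
  rewrite Nx eis_norm_int !dvdzE abszX => h.
  have : (q %| `|n| ^ 2)%N by apply: dvdn_trans h; rewrite dvdn_exp.
  by rewrite Euclid_dvdX // andbT.
have pn' : ~ eis_dvd pi n%:~R.
  move/eis_dvd_norm; rewrite Np eis_norm_int !dvdzE abszX Euclid_dvdX // andbT.
  by move=> h; move: pn; rewrite dvdzE h.
have s0 : cubic_symbol n%:~R pi != 0 by apply/eqP => /(cubic_symbol_eq0 _ Pp Qp).
rewrite cubic_jacobiM // pmulrn cubic_jacobi_int //; last first.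
  by apply: coprimez_eis; rewrite coprimezE absz_nat prime_coprime // -[X in ~~ X]/(_ %| _)%Z.
rewrite mul1r intrM cubic_symbolM // => E.
have [hv _] := cubic_symbolP n%:~R Pp Qp.
have := cubic_values_cube hv s0; move: E.
move: (cubic_jacobi _ _) (cubic_symbol _ _) => a b E b3.
by rewrite -[a]mulr1 -b3 -[RHS]mul1r -E; ring.
Qed.

(** Both sides are multiplicative in [gamma], which may thus be taken prime.
    For a rational prime both symbols are 1. *)
Theorem cubic_reciprocity_rational gamma (n : int) :
  primary_up_to_sign gamma -> ~~ (3 %| n)%Z -> eis_coprime gamma n%:~R ->
  cubic_jacobi gamma n%:~R = cubic_jacobi n%:~R gamma.
Proof.
move=> hg n3 co; have [s hs] := primary_factorization_exists hg.
have hn := primary_up_to_sign_int n3.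
transitivity (cubic_jacobi (\prod_(x <- s) x) n%:~R).
  by case: hs => _ [] -> //; rewrite cubic_jacobiN.
rewrite (cubic_jacobiE _ hs).
rewrite (big_morph (fun x => cubic_jacobi x n%:~R) (cubic_jacobiM hn) (cubic_jacobi1 hn)).
apply: eq_big_seq => pi pis; have [Pp Qp] := proj1 hs pi pis.
have pg := primary_factorization_dvd hs pis.
have npn : ~ eis_dvd pi n%:~R.
  by move=> h; apply: (eis_coprime_ndvd Pp co h pg).
have [q [k [q_pr q3 pq Nq [k1|[m Em]]]]] := primary_prime_classify Pp Qp.
  apply: (cubic_reciprocity_prime (p := q)) => //; first by rewrite Nq k1 expn1.
  apply/negP => qn; apply: npn; apply: eis_dvd_trans pq _.
  by rewrite pmulrn; apply: eis_dvd_int.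
have m3 : ~~ (3 %| m)%Z.
  by have /andP[] := primary_primary_up_to_sign Qp; rewrite Em ere_int.
have co' := eis_prime_coprime Pp npn.
have <- : cubic_jacobi n%:~R pi = cubic_symbol n%:~R pi.
  by rewrite (cubic_jacobiE _ (primary_prime_factorization Pp Qp)) big_seq1.
rewrite Em in co' *; rewrite !cubic_jacobi_int //.
exact: eis_coprime_sym.
Qed.

(** * The elements r P - 3 u theta *)

Lemma eis_dvd_intP (m : int) z : (m %| ere z)%Z -> (m %| eom z)%Z ->
  eis_dvd m%:~R z.
Proof.
move=> /dvdzP[a Ea] /dvdzP[b Eb]; exists (Eisenstein a b).
by apply: eisP; rewrite ?Ea ?Eb !eisE /=; ring.
Qed.

Lemma coprimez_dvd_comb (N m n x : int) : coprimez N m -> coprimez x n ->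
  (x %| N - m * n)%Z -> coprimez N x.
Proof.
move=> cNm cxn xd; set g := gcdz N x.
have gN : (g %| N)%Z by apply: dvdz_gcdl.
have gx : (g %| x)%Z by apply: dvdz_gcdr.
have gmn : (g %| m * n)%Z.
  by rewrite -[m * n](subKr N) rpredB //; apply: dvdz_trans gx xd.
have gn : (g %| n)%Z.
  by rewrite -(@Gauss_dvdzr _ m) //; apply: coprimez_dvdl gN cNm.
have : (g %| 1%R)%Z.
  case/coprimezP: cxn => -[a b] /= <-.
  by rewrite rpredD // dvdz_mull.
by rewrite dvdz1 coprimezE.
Qed.

Lemma coprimez3 n : ~~ (3 %| n)%Z -> coprimez n 3.
Proof. by rewrite coprimez_sym coprimezE dvdzE => h; rewrite prime_coprime. Qed.

(** Reciprocity gives the symbol of [n] over [gamma]. The multiple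
    [27 ^+ k * n] is congruent to [- r ^+ 2 * (2 ^+ q1 * z ^+ 3)] modulo
    [gamma], because [gamma] divides its norm, and cubes have symbol 1. *)
Lemma cubic_jacobi_norm_eq1 gamma (n r z : int) (q1 k : nat) :
  primary_up_to_sign gamma -> ~~ (3 %| n)%Z -> ~~ (3 %| r)%Z ->
  eis_norm gamma = 27 ^+ k * n + r ^+ 2 * (2 ^+ q1 * z ^+ 3) ->
  coprimez n (2 ^+ q1 * z ^+ 3) -> coprimez r n ->
  cubic_jacobi gamma r%:~R = 1 ->
  ((0 < q1)%N -> cubic_jacobi gamma 2%:~R = 1) ->
  cubic_jacobi gamma n%:~R = 1.
Proof.
move=> hg n3 r3; set R := 2 ^+ q1 * z ^+ 3 => EN cnR crn gr g2.
have N3 : coprimez (eis_norm gamma) 3 by apply/coprimez3/primary_up_to_sign_norm.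
have N27 : coprimez (eis_norm gamma) (27 ^+ k).
  by apply: coprimezXr; rewrite -[27]/(3 ^+ 3 : int); apply: coprimezXr.
have Nx x : (x %| r ^+ 2 * R)%Z -> coprimez x n -> coprimez (eis_norm gamma) x.
  by move=> xd cx; apply: coprimez_dvd_comb N27 cx _; rewrite EN addrAC subrr add0r.
have rd x : (x %| R)%Z -> coprimez x n.
  by move=> h; rewrite coprimez_sym; apply: coprimez_dvdr h cnR.
have cog x : coprimez (eis_norm gamma) x -> eis_coprime gamma x%:~R.
  exact: eis_coprime_norm.
have con : eis_coprime gamma n%:~R.
  apply: cog; rewrite coprimez_sym EN; apply/coprimezP.
  have : coprimez n (r ^+ 2 * R).
    by rewrite coprimezMr cnR coprimezXr // coprimez_sym.
  case/coprimezP=> -[a b] /= E; exists (a - b * 27 ^+ k, b) => /=.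
  by rewrite -E; ring.
have sym3 x : coprimez (eis_norm gamma) x -> cubic_jacobi x%:~R gamma ^+ 3 = 1.
  by move=> cx; apply: cubic_jacobi_cube => //; apply/eis_coprime_sym/cog.
rewrite cubic_reciprocity_rational //.
transitivity (cubic_jacobi (27 ^+ k * n)%:~R gamma).
  rewrite intrM cubic_jacobiM // -[27 ^+ k]/((3 ^+ 3) ^+ k) -exprM mulnC exprM.
  by rewrite [in X in X * _]rmorphXn /= cubic_jacobiX // sym3 ?mul1r // coprimezXr.
transitivity (cubic_jacobi (- (r ^+ 2 * R))%:~R gamma).
  apply: cubic_jacobi_congr => //; rewrite -rmorphB opprK /=.
  by rewrite -EN; apply: eis_dvd_self_norm.
rewrite mulrNz cubic_jacobiN //.
have -> : (r ^+ 2 * R)%:~R = r%:~R ^+ 2 * (2%:~R ^+ q1 * z%:~R ^+ 3) :> eisenstein.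
  by rewrite /R !intrM !rmorphXn /=; ring.
rewrite cubic_jacobiM // [X in _ * X]cubic_jacobiM // !cubic_jacobiX //.
rewrite (sym3 z) ?mulr1; last first.
  have zR : (z %| R)%Z by rewrite /R exprS mulrCA dvdz_mulr.
  by apply: Nx; [apply: dvdz_mull | apply: rd].
have -> : cubic_jacobi r%:~R gamma = 1.
  rewrite -cubic_reciprocity_rational //; apply: cog; apply: Nx => //.
  by rewrite expr2 -mulrA dvdz_mulr.
rewrite expr1n mul1r; have [->|q1_gt0] := posnP q1; first by rewrite expr0.
have R2 : (2 %| R)%Z by rewrite /R -(prednK q1_gt0) exprS -mulrA dvdz_mulr.
rewrite -(@cubic_reciprocity_rational _ 2) ?g2 ?expr1n //; apply: cog; apply: Nx.
  exact: dvdz_mull.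
exact: rd.
Qed.

End EisensteinIntegers.

Definition theta : eisenstein := 1 + 2 * omega.

Lemma theta_sq : theta ^+ 2 = - 3.
Proof. by apply/eqP. Qed.

(** The square of [theta] is the rational integer -3. *)
Lemma cubic_jacobi_theta (n : int) : ~~ (3 %| n)%Z -> cubic_jacobi theta n%:~R = 1.
Proof.
move=> n3; have hn := primary_up_to_sign_int n3.
have c3 : coprimez 3 n by rewrite coprimez_sym coprimez3.
have co : eis_coprime theta n%:~R by apply: eis_coprime_norm.
have := cubic_jacobi_cube hn co; rewrite exprS -cubic_jacobiX // theta_sq.
rewrite cubic_jacobiN // -[3]/(3%:~R) cubic_jacobi_int ?mulr1 //.
exact: coprimez_eis.
Qed.

Definition gam (P r u : int) : eisenstein := (r * P)%:~R - (3 * u)%:~R * theta.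

Lemma ere_gam P r u : ere (gam P r u) = r * P - 3 * u.
Proof. by rewrite /gam /theta !eisE /=; ring. Qed.
Lemma eom_gam P r u : eom (gam P r u) = - (6 * u).
Proof. by rewrite /gam /theta !eisE /=; ring. Qed.
Lemma gam_norm P r u : eis_norm (gam P r u) = r ^+ 2 * P ^+ 2 + 27 * u ^+ 2.
Proof. by rewrite /eis_norm ere_gam eom_gam; ring. Qed.

Lemma primary_up_to_sign_gam P r u : ~~ (3 %| P)%Z -> ~~ (3 %| r)%Z ->
  primary_up_to_sign (gam P r u).
Proof.
move=> P3 r3; rewrite /primary_up_to_sign ere_gam eom_gam.
have : ~~ (3 %| r * P)%Z by rewrite dvdzE abszM Euclid_dvdM // negb_or -!dvdzE r3.
by move: (r * P) => x {P3 r3}; lia.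
Qed.

Lemma dvdz2_mul_pred (x : int) : (2 %| x * (x - 1))%Z.
Proof.
have [x2|x2] := boolP (2 %| x)%Z; first exact: dvdz_mulr.
by apply: dvdz_mull; lia.
Qed.

Lemma odd_of_norm_form (u D r : int) :
  ~~ (2 %| u ^+ 2 - D * r ^+ 2)%Z -> ~~ (2 %| u + r * D)%Z.
Proof.
apply: contra => /dvdzP[m' Em].
have -> : u ^+ 2 - D * r ^+ 2 = 2 * (2 * m' ^+ 2 - 2 * m' * (r * D)) + r ^+ 2 * (D * (D - 1)).
  have -> : u = m' * 2 - r * D by rewrite -Em addrK.
  ring.
apply: rpredD; first exact: dvdz_mulr.
by apply: dvdz_mull; apply: dvdz2_mul_pred.
Qed.

Lemma dvdz2_sq_add (P D : int) : (2 %| P ^+ 2 + 27 * D)%Z -> (2 %| P - D)%Z.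
Proof.
have -> : P ^+ 2 + 27 * D = P * (P - 1) + (P - D) + 2 * (14 * D) by ring.
by have := dvdz2_mul_pred P; move: (P * (P - 1)) => y; lia.
Qed.

Lemma ere_sub1 (z : eisenstein) : ere (z - 1) = ere z - 1. Proof. by []. Qed.
Lemma eom_sub1 (z : eisenstein) : eom (z - 1) = eom z. Proof. by rewrite eomD addr0. Qed.

Section Core.
Variables P D Q : int.
Hypothesis hP : ~~ (3 %| P)%Z \/ (27 %| P)%Z.
Hypothesis hQ : Q = P ^+ 2 + 27 * D.
Hypothesis hq : exists (q1 : nat) (q0 : int), (q1 <= 2)%N /\ Q = 2 ^+ q1 * q0 ^+ 3.

(** The factor [27 ^+ k] allows vectors with values divisible by 27 in the
    chains below. *)
Lemma cubic_jacobi_gam_eq1 (r u n : int) k :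
  27 ^+ k * n = u ^+ 2 - D * r ^+ 2 ->
  ~~ (3 %| n)%Z -> ~~ (3 %| u)%Z -> ~~ (3 %| r)%Z ->
  coprimez n Q -> coprimez r n -> cubic_jacobi (gam P r u) n%:~R = 1.
Proof.
move=> En n3 u3 r3 cnQ crn; have [q1 [q0 [_ EQ]]] := hq.
have hr := primary_up_to_sign_int r3; have hn := primary_up_to_sign_int n3.
have r3' := coprimez3 r3; have n3' := coprimez3 n3.
have cru : coprimez r u.
  have : coprimez r (27 ^+ k * n).
    by rewrite coprimezMr crn coprimezXr // -[27]/(3 ^+ 3 : int) coprimezXr.
  case/coprimezP => -[a b] /= E; apply/coprimezP.
  exists (a - b * D * r, b * u) => /=; rewrite -E En; ring.
(* Modulo r, gamma is - 3 u theta, and gamma / theta ^+ 3 is u if 27 divides P. *)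
have ur1 : cubic_jacobi u%:~R r%:~R = 1.
  by rewrite cubic_jacobi_int //; apply: coprimez_eis; rewrite coprimez_sym.
have parity : (2 %| Q)%Z -> ~~ (2 %| u + r * D)%Z.
  move=> Q2; apply: (@odd_of_norm_form u D r); rewrite -En.
  apply/negP; rewrite Gauss_dvdzr; last by rewrite coprimezXr.
  move=> n2; have : (2 %| gcdz n Q)%Z by rewrite dvdz_gcd n2.
  by move/eqP: cnQ => ->.
case: hP => [P3|/dvdzP[P' EP]].
  have hg := primary_up_to_sign_gam u P3 r3.
  apply: (@cubic_jacobi_norm_eq1 _ n r q0 q1 k.+1) => //.
  - by rewrite gam_norm -EQ [27 ^+ _.+1]exprS -mulrA En hQ; ring.
  - by rewrite -EQ.
  - transitivity (cubic_jacobi (- (3%:~R * u%:~R * theta)) r%:~R).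
      apply: cubic_jacobi_congr => //; rewrite /gam.
      exists P%:~R; rewrite !intrM; ring.
    rewrite cubic_jacobiN // !cubic_jacobiM // cubic_jacobi_theta // ur1 !mulr1.
    by rewrite cubic_jacobi_int //; apply: coprimez_eis; rewrite coprimez_sym.
  move=> q1_gt0; have Q2 : (2 %| Q)%Z.
    by rewrite EQ -(prednK q1_gt0) exprS -mulrA dvdz_mulr.
  transitivity (cubic_jacobi 1 2%:~R); last exact: cubic_jacobi1.
  apply: cubic_jacobi_congr => //.
  have : (2 %| P - D)%Z by apply: dvdz2_sq_add; rewrite -hQ.
  move: (parity Q2) => odd1 /dvdzP[s Es]; apply: eis_dvd_intP;
    rewrite ?ere_sub1 ?eom_sub1 ?ere_gam ?eom_gam.
    have -> : r * P = r * D + 2 * (r * s) by rewrite -[P](subrK D) Es; ring.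
    move: odd1; clear.
    by move: (r * D) (r * s) => x y; lia.
  by clear; lia.
(* Here 27 divides P: gamma = theta ^+ 3 * g, where g is primary up to sign. *)
set g := u%:~R + (3 * r * P')%:~R * theta.
have Eg : gam P r u = theta ^+ 3 * g.
  rewrite exprS theta_sq /gam /g EP; rewrite !intrM.
  have T : theta * theta = -3 by rewrite -expr2 theta_sq.
  by ring: T.
have ereg : ere g = u + 3 * (r * P') by rewrite /g /theta !eisE /=; ring.
have eomg : eom g = 6 * (r * P') by rewrite /g /theta !eisE /=; ring.
have hg : primary_up_to_sign g.
  rewrite /primary_up_to_sign ereg eomg; move: u3; clear.
  by move: (r * P') => x; lia.
rewrite Eg cubic_jacobiM // cubic_jacobiX // cubic_jacobi_theta // expr1n mul1r.
have [q0' Eq0] : exists q0', q0 = 3 * q0'.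
  have : (3 %| 2 ^+ q1 * q0 ^+ 3)%Z.
    rewrite -EQ hQ EP.
    have -> : (P' * 27) ^+ 2 + 27 * D = 3 * (243 * P' ^+ 2 + 9 * D) by ring.
    exact: dvdz_mulr.
  rewrite Gauss_dvdzr; last by rewrite coprimezXr.
  rewrite dvdzE abszX Euclid_dvdX // andbT -dvdzE => /dvdzP[q0' ->].
  by exists q0'; rewrite mulrC.
have EQ' : 2 ^+ q1 * q0' ^+ 3 = D + 27 * P' ^+ 2.
  have : 27 * (2 ^+ q1 * q0' ^+ 3) = 27 * (D + 27 * P' ^+ 2).
    rewrite -[LHS](_ : 2 ^+ q1 * q0 ^+ 3 = _); last by rewrite Eq0; ring.
    by rewrite -EQ hQ EP; ring.
  exact: mulfI.
have dQ : (2 ^+ q1 * q0' ^+ 3 %| Q)%Z.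
  by apply/dvdzP; exists 27; rewrite EQ Eq0; ring.
apply: (@cubic_jacobi_norm_eq1 _ n r q0' q1 k) => //.
- rewrite En EQ' eis_norm_sq ereg eomg; ring.
- exact: coprimez_dvdr dQ cnQ.
- transitivity (cubic_jacobi u%:~R r%:~R) => //; apply: cubic_jacobi_congr => //.
  by exists ((3 * P')%:~R * theta); rewrite /g !intrM; ring.
move=> q1_gt0; have Q2 : (2 %| Q)%Z.
  by rewrite EQ -(prednK q1_gt0) exprS -mulrA dvdz_mulr.
transitivity (cubic_jacobi 1 2%:~R); last exact: cubic_jacobi1.
apply: cubic_jacobi_congr => //.
have : (2 %| P' ^+ 2 + 27 * D)%Z.
  have -> : P' ^+ 2 + 27 * D = 2 ^+ q1 * q0' ^+ 3 + 2 * (13 * D - 13 * P' ^+ 2).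
    by rewrite EQ'; ring.
  apply: rpredD; last exact: dvdz_mulr.
  by rewrite -(prednK q1_gt0) exprS -mulrA dvdz_mulr.
move/dvdz2_sq_add => /dvdzP[s Es]; move: (parity Q2) => odd1.
apply: eis_dvd_intP; rewrite ?ere_sub1 ?eom_sub1 ?ereg ?eomg.
  have -> : r * P' = r * D + 2 * (r * s) by rewrite -[P'](subrK D) Es; ring.
  move: odd1; clear.
  by move: (r * D) (r * s) => x y; lia.
by clear; move: (r * P') => x; lia.
Qed.

End Core.

(** * Vectors of a binary quadratic form *)

Lemma coprimez_primes (m n : int) :
  (forall l : nat, prime l -> (l %| m)%Z -> ~~ (l %| n)%Z) -> coprimez m n.
Proof.
move=> h; rewrite coprimezE; apply: contraT => co.
have [g0|g0] := posnP (gcdn `|m| `|n|).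
  have := h 2 isT; rewrite !dvdzE; move/eqP: g0; rewrite eqn0Ngt gcdn_gt0 negb_or.
  by rewrite -!eqn0Ngt => /andP[/eqP -> /eqP ->] /(_ isT).
have g1 : (1 < gcdn `|m| `|n|)%N by move: co g0; rewrite /coprime; lia.
have := pdiv_dvd (gcdn `|m| `|n|); rewrite dvdn_gcd => /andP[lm ln].
by have := h _ (pdiv_prime g1); rewrite !dvdzE /= lm ln => /(_ isT).
Qed.

Lemma dvdz_prime_mul (l : nat) (m n : int) : prime l ->
  (l %| m * n)%Z = (l %| m)%Z || (l %| n)%Z.
Proof. by move=> lp; rewrite !dvdzE abszM Euclid_dvdM. Qed.

Lemma dvdz_prime_exp (l : nat) (m : int) k : prime l ->
  (l %| m ^+ k.+1)%Z = (l %| m)%Z.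
Proof. by move=> lp; rewrite !dvdzE abszX Euclid_dvdX // andbT. Qed.

Lemma sqr_mod3 (x : int) : ~~ (3 %| x)%Z -> (3 %| x ^+ 2 - 1)%Z.
Proof.
move=> x3; have -> : x ^+ 2 - 1 = (x - 1) * (x + 1) by ring.
by rewrite (@dvdz_prime_mul 3) //; lia.
Qed.

Lemma ere_conj (z : eisenstein) : ere (eis_conj z) = ere z - eom z. Proof. by []. Qed.
Lemma eom_conj (z : eisenstein) : eom (eis_conj z) = - eom z. Proof. by []. Qed.

Section Form.
Variables a b c : int.

Definition qform (v : int * int) : int :=
  a * v.1 ^+ 2 + 2 * b * v.1 * v.2 + c * v.2 ^+ 2.
Definition bform (v w : int * int) : int :=
  a * v.1 * w.1 + b * (v.1 * w.2 + v.2 * w.1) + c * v.2 * w.2.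
Definition det2 (v w : int * int) : int := v.1 * w.2 - v.2 * w.1.
Definition primvec (v : int * int) := coprimez v.1 v.2.

Local Notation D := (b ^+ 2 - a * c).

Lemma qformM v w : qform v * qform w = bform v w ^+ 2 - D * det2 v w ^+ 2.
Proof. by rewrite /qform /bform /det2; ring. Qed.

Lemma bformC v w : bform v w = bform w v.
Proof. by rewrite /bform; ring. Qed.
Lemma det2C v w : det2 v w = - det2 w v.
Proof. by rewrite /det2; ring. Qed.

(** Decompose [w] along [v] and a second vector completing [v] to a basis. *)
Lemma qform_primvec v w : primvec v ->
  exists k x, qform w = k ^+ 2 * qform v + det2 v w * x.
Proof.
case/coprimezP => -[al be] /= E.
set k := al * w.1 + be * w.2; set r := det2 v w.
have E1 : w.1 = k * v.1 - r * be by rewrite -[LHS]mulr1 -E /k /r /det2; ring.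
have E2 : w.2 = k * v.2 + r * al by rewrite -[LHS]mulr1 -E /k /r /det2; ring.
exists k; exists (a * (r * be ^+ 2 - 2 * k * v.1 * be)
   + 2 * b * (k * v.1 * al - be * k * v.2 - r * be * al)
   + c * (2 * k * v.2 * al + r * al ^+ 2)).
by rewrite {1}/qform E1 E2 /qform; ring.
Qed.

(** A common prime divisor of the determinant and of the value at [v] also
    divides the value at [w], by [qform_primvec]. *)
Lemma coprimez_det2 v w (n m : int) i j : primvec v ->
  qform v = 27 ^+ i * n -> qform w = 27 ^+ j * m ->
  coprimez n m -> ~~ (3 %| n)%Z -> coprimez (det2 v w) n.
Proof.
move=> pv Ev Ew cnm n3; have [k [x Ek]] := qform_primvec w pv.
have : coprimez n (27 ^+ j * m).
  rewrite coprimezMr cnm andbT coprimezXr // -[27]/(3 ^+ 3 : int) coprimezXr //.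
  exact: coprimez3.
case/coprimezP=> -[s t] /= E; apply/coprimezP.
exists (t * x, s + t * k ^+ 2 * 27 ^+ i) => /=.
by rewrite -[RHS]E -Ew Ek Ev; ring.
Qed.

Variables P Q : int.
Hypothesis hP : ~~ (3 %| P)%Z \/ (27 %| P)%Z.
Hypothesis hQ : Q = P ^+ 2 + 27 * D.
Hypothesis hq : exists (q1 : nat) (q0 : int), (q1 <= 2)%N /\ Q = 2 ^+ q1 * q0 ^+ 3.

Local Notation gamv v w := (gam P (det2 v w) (bform v w)).

(** If [det2 v z = 1], then the form is equivalent to (n', 2b', c') with
    [n' = qform v] and [b' = bform v z], and [gam P 1 b'] is the element
    P - 3b'(1 + 2 omega). Any [z] with determinant prime to [n] serves as
    well. The parameter [n] is the value at [v], up to a power of 27. *)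
Definition trivial_symbol v (n : int) := exists2 z,
  coprimez (det2 v z) n & cubic_jacobi (gamv v z) n%:~R = 1.

(** The ratio of the elements attached to [z] and to [z'] is rational
    modulo [n]. *)
Lemma trivial_symbol_all v n i z : qform v = 27 ^+ i * n -> ~~ (3 %| n)%Z ->
  trivial_symbol v n -> coprimez (det2 v z) n ->
  cubic_jacobi (gamv v z) n%:~R = 1.
Proof.
move=> Ev n3 [z' cz' z'1] cz; have hn := primary_up_to_sign_int n3.
have h x : coprimez x n -> cubic_jacobi x%:~R n%:~R = 1.
  by move=> cx; apply: cubic_jacobi_int => //; apply: coprimez_eis.
have : cubic_jacobi ((det2 v z')%:~R * gamv v z) n%:~R =
       cubic_jacobi ((det2 v z)%:~R * gamv v z') n%:~R.
  apply: cubic_jacobi_congr => //.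
  exists ((3 * 27 ^+ i * det2 z' z)%:~R * theta).
  have : (det2 v z)%:~R * (bform v z')%:~R - (det2 v z')%:~R * (bform v z)%:~R
     = (27 ^+ i * n * det2 z' z)%:~R :> eisenstein.
    rewrite -Ev -!intrM -intrB; congr (_%:~R).
    by rewrite /qform /bform /det2; ring.
  rewrite /gam !intrM => /eqP; rewrite subr_eq => /eqP E.
  by ring: E.
by rewrite !cubic_jacobiM // z'1 !h // !mul1r.
Qed.

Lemma eis_conj_gam r u : eis_conj (gam P r u) = - gam P (- r) u.
Proof.
apply: eisP.
  by rewrite ere_conj ereN !ere_gam eom_gam; ring.
by rewrite eom_conj eomN !eom_gam; ring.
Qed.

(** The element attached to the pair ([v], [w]) serves for [v], and minus its
    conjugate serves for [w]. Its symbol over [n * m] is 1. *)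
Lemma trivial_symbol_step v w (n m : int) i j : primvec v -> primvec w ->
  qform v = 27 ^+ i * n -> qform w = 27 ^+ j * m ->
  coprimez n m -> ~~ (3 %| n)%Z -> ~~ (3 %| m)%Z ->
  coprimez n Q -> coprimez m Q ->
  ~~ (3 %| det2 v w)%Z -> ~~ (3 %| bform v w)%Z ->
  trivial_symbol v n -> trivial_symbol w m.
Proof.
move=> pv pw Ev Ew cnm n3 m3 cnQ cmQ r3 u3 vn.
have crn := coprimez_det2 pv Ev Ew cnm n3.
have cmn : coprimez m n by rewrite coprimez_sym.
have crm : coprimez (det2 v w) m.
  by have := coprimez_det2 pw Ew Ev cmn m3; rewrite det2C !coprimezE abszN.
have hn := primary_up_to_sign_int n3; have hm := primary_up_to_sign_int m3.
have : cubic_jacobi (gamv v w) (n * m)%:~R = 1.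
  apply: (@cubic_jacobi_gam_eq1 P D Q hP hQ hq _ _ _ (i + j)) => //.
  - by rewrite -qformM Ev Ew exprD; ring.
  - by rewrite (@dvdz_prime_mul 3) // negb_or n3.
  - by rewrite coprimezMl cnQ.
  - by rewrite coprimezMr crn.
rewrite intrM cubic_jacobi_mulr // (trivial_symbol_all Ev) // mul1r => E.
exists v; first by rewrite det2C !coprimezE abszN -!coprimezE.
rewrite (det2C w v) (bformC w v).
rewrite -[gam _ _ _]opprK cubic_jacobiN // -eis_conj_gam -(eis_conj_int m).
by rewrite cubic_jacobi_conj // E rmorph1.
Qed.

Hypothesis prim_form : forall l : nat, prime l -> exists v, ~~ (l %| qform v)%Z.

(** * Chains of vectors *)

Definition vcong (m : int) (v w : int * int) :=
  (m %| v.1 - w.1)%Z && (m %| v.2 - w.2)%Z.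

Lemma qform_cong m v w : vcong m v w -> (m %| qform v - qform w)%Z.
Proof.
case: v w => [x y] [x' y'] /andP[/= /dvdzP[s Es] /dvdzP[t Et]].
have -> : x = s * m + x' by rewrite -Es subrK.
have -> : y = t * m + y' by rewrite -Et subrK.
apply/dvdzP; exists (s * (a * (s * m + 2 * x') + 2 * b * (t * m + y'))
  + t * (2 * b * x' + c * (t * m + 2 * y'))).
by rewrite /qform /=; ring.
Qed.

Lemma vcong_ndvd (l m : int) v w : vcong m v w -> (l %| m)%Z ->
  ~~ (l %| qform w)%Z -> ~~ (l %| qform v)%Z.
Proof.
move=> /qform_cong h lm; apply: contra => lv.
by rewrite -[qform w](subKr (qform v)) rpredB //; apply: dvdz_trans lm h.
Qed.

(** Chinese remaindering: a primitive form takes a value prime to [l] for each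
    prime [l]. *)
Lemma avoid_primes (L : seq nat) (w0 : int * int) : uniq L ->
  (forall l, l \in L -> prime l /\ l != 3%N) ->
  exists2 w, vcong 81 w w0 & forall l : nat, l \in L -> ~~ (l %| qform w)%Z.
Proof.
elim: L => [|l L IHL] /= => [_ _|/andP[lL uL] hL].
  by exists w0 => //; rewrite /vcong !subrr !dvdz0.
have [|w ww0 hw] := IHL uL; first by move=> l' l'L; apply: hL; rewrite inE l'L orbT.
have [l_pr l3] := hL l (mem_head _ _); have [e he] := prim_form l_pr.
pose M := (81 * \prod_(l' <- L) l')%N.
have co : coprimez M l.
  rewrite coprimezE !absz_nat coprime_sym prime_coprime // Euclid_dvdM // negb_or.
  rewrite -[81%N]/(3 ^ 4)%N Euclid_dvdX // andbT dvdn_prime2 // l3.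
  rewrite Euclid_dvd_prod // big_has; apply/hasPn => l' l'L.
  have [l'_pr _] : prime l' /\ l' != 3%N by apply: hL; rewrite inE l'L orbT.
  by rewrite dvdn_prime2 //; apply: contraNneq lL => ->.
exists (zchinese M l w.1 e.1, zchinese M l w.2 e.2).
  have : vcong 81 (zchinese M l w.1 e.1, zchinese M l w.2 e.2) w.
    have h81 : (81 %| M%:Z)%Z by rewrite /M PoszM dvdz_mulr.
    apply/andP; split; apply: dvdz_trans h81 _; rewrite -eqz_mod_dvd;
      by rewrite zchinese_modl.
  move: ww0 => /andP[w1 w2] /andP[u1 u2]; apply/andP.
  by split; [rewrite -(subrKA w.1) | rewrite -(subrKA w.2)]; rewrite rpredD.
move=> l'; rewrite inE => /orP[/eqP->|l'L].
  apply: (vcong_ndvd (m := l)) he => //; apply/andP.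
  by split; rewrite -eqz_mod_dvd zchinese_modr.
apply: (vcong_ndvd (m := M)) (hw _ l'L).
  by apply/andP; split; rewrite -eqz_mod_dvd zchinese_modl.
by rewrite dvdzE /= /M (perm_big _ (perm_to_rem l'L)) big_cons mulnCA dvdn_mulr.
Qed.

Lemma primvec_scale v : v != (0, 0) -> exists d w,
  [/\ primvec w, v = (d * w.1, d * w.2) & d != 0].
Proof.
case: v => x y v0; set d := gcdz x y.
have d0 : d != 0.
  by apply: contraNneq v0 => /eqP; rewrite /d gcdz_eq0 => /andP[/eqP -> /eqP ->].
have [x' Ex] := dvdzP (dvdz_gcdl x y); have [y' Ey] := dvdzP (dvdz_gcdr x y).
exists d, (x', y'); split=> //; last by congr (_, _); rewrite /= mulrC.
rewrite /primvec /=; have [u [v Euv]] := Bezoutz x y.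
apply/coprimezP; exists (u, v) => /=; apply: (mulIf d0).
have -> : (u * x' + v * y') * d = u * (x' * d) + v * (y' * d) by ring.
by rewrite mul1r -Ex -Ey.
Qed.

Lemma qform_scale d w : qform (d * w.1, d * w.2) = d ^+ 2 * qform w.
Proof. by rewrite /qform /=; ring. Qed.

(** The content [s] of the vector produced by [avoid_primes] is prime to 3 and
    can be divided out. *)
Lemma primvec_avoiding (w0 : int * int) (N : int) : N != 0 ->
  ~~ (3 %| w0.1)%Z || ~~ (3 %| w0.2)%Z ->
  exists w s, [/\ primvec w, ~~ (3 %| s)%Z, vcong 81 (s * w.1, s * w.2) w0 &
    forall l : nat, prime l -> l != 3%N -> (l %| N)%Z -> ~~ (l %| qform w)%Z].
Proof.
move=> N0 w03; pose L := [seq l <- primes `|N|%N | l != 3%N].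
have [||v vw0 hv] := @avoid_primes L w0.
- by rewrite filter_uniq ?primes_uniq.
- by move=> l; rewrite mem_filter mem_primes => /and4P[-> ->].
have v3 : ~~ (3 %| v.1)%Z || ~~ (3 %| v.2)%Z.
  by case/andP: vw0; move: w03; clear; lia.
have [|s [w [pw Ev s0]]] := @primvec_scale v.
  by apply: contraTneq v3 => ->.
exists w, s; split=> //; last 1 first.
- move=> l l_pr l3 lN; have : l \in L.
    by rewrite mem_filter l3 mem_primes l_pr absz_gt0 N0.
  by move/hv; apply: contra; rewrite Ev qform_scale; apply: dvdz_mull.
- by move: v3; rewrite Ev /=; case: (boolP (3 %| s)%Z) => // h; rewrite !dvdz_mulr.
- by rewrite -Ev.
Qed.

(** The square of this linear map is multiplication by [D]. *)
Definition sqrtD_act (v : int * int) : int * int :=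
  (- (b * v.1 + c * v.2), a * v.1 + b * v.2).

Definition rotate (e : int) (v : int * int) : int * int :=
  (v.1 + e * (sqrtD_act v).1, v.2 + e * (sqrtD_act v).2).

Lemma qform_rotate e v : qform (rotate e v) = (1 - D * e ^+ 2) * qform v.
Proof. by rewrite /qform /=; ring. Qed.
Lemma det2_rotate e v w : det2 w (rotate e v) = det2 w v + e * bform v w.
Proof. by rewrite /det2 /bform /=; ring. Qed.
Lemma bform_rotate e v w : bform w (rotate e v) = bform v w + e * D * det2 w v.
Proof. by rewrite /det2 /bform /=; ring. Qed.
Lemma det2vv v : det2 v v = 0. Proof. by rewrite /det2; ring. Qed.
Lemma bformvv v : bform v v = qform v. Proof. by rewrite /bform /qform; ring. Qed.

(** The conditions at 3 of [cubic_jacobi_gam_eq1], in a form which covers the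
    two cases of the hypothesis on [P]. *)
Definition mod3_generic v w := ~~ (3 %| det2 v w)%Z && ~~ (3 %| bform v w)%Z.

(** Among the two vectors [rotate e v0] one is suitable. Modulo 3, if [D = 0]
    then [bform v0 v1] is nonzero and [e] avoids one zero of the determinant;
    if [D = -1] and the values agree, then the squares of [bform v0 v1] and
    [det2 v0 v1] add up to 1, so exactly one of the two vanishes. *)
Lemma direction_mod3 v0 v1 : ~~ (3 %| D - 1)%Z ->
  ~~ (3 %| qform v0)%Z -> ~~ (3 %| qform v1)%Z ->
  (3 %| D)%Z \/ (3 %| qform v0 - qform v1)%Z ->
  exists w, [/\ ~~ (3 %| qform w)%Z, mod3_generic v0 w & mod3_generic v1 w].
Proof.
move=> D1 q0 q1 hD; have := qformM v0 v1.
have -> : det2 v0 v1 ^+ 2 = det2 v1 v0 ^+ 2 by rewrite det2C sqrrN.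
set be := bform v0 v1; set de := det2 v1 v0 => E.
have q01 : ~~ (3 %| qform v0 * qform v1)%Z.
  by rewrite (@dvdz_prime_mul 3) // negb_or q0.
suff [e [e1 e2 e3]] : exists e : int,
    [/\ e ^+ 2 = 1, ~~ (3 %| de + e * be)%Z & ~~ (3 %| be + e * D * de)%Z].
  exists (rotate e v0); split.
  - rewrite qform_rotate e1 (@dvdz_prime_mul 3) // negb_or q0 andbT.
    by move: D1; clear; move: D => x; lia.
  - rewrite /mod3_generic det2_rotate bform_rotate det2vv bformvv mulr0 addr0 q0 add0r.
    rewrite (@dvdz_prime_mul 3) // negb_or q0 andbT andbT.
    by move: e1; clear; nia.
  - by rewrite /mod3_generic det2_rotate bform_rotate -/be -/de e2 e3.
move: E q01 D1 hD; move: D => d; case: (boolP (3 %| d)%Z) => [d3 E q01 _ _|d3 E q01 d1 []].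
- have be3 : ~~ (3 %| be)%Z.
    apply: contra q01 => h; rewrite E rpredB // ?dvdz_mulr // expr2 dvdz_mulr //.
  have hd e : ~~ (3 %| be + e * d * de)%Z.
    apply: contra be3 => h; rewrite -[be](addrK (e * d * de)) rpredB //.
    by rewrite mulrAC dvdz_mull.
  case: (boolP (3 %| de + be)%Z) => h.
    by exists (-1); split=> //; move: h be3; clear; lia.
  by exists 1; split=> //; rewrite mul1r.
- by [].
move=> q0q1; have sq : (3 %| be ^+ 2 + de ^+ 2 - 1)%Z.
  have h0 := sqr_mod3 q0.
  have -> : be ^+ 2 + de ^+ 2 - 1 = qform v0 ^+ 2 - 1 - qform v0 * (qform v0 - qform v1)
     + (d + 1) * de ^+ 2.
    have -> : qform v0 ^+ 2 - 1 - qform v0 * (qform v0 - qform v1) =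
      qform v0 * qform v1 - 1 by ring.
    by rewrite E; ring.
  apply: rpredD; first by apply: rpredB => //; apply: dvdz_mull.
  by apply: dvdz_mulr; move: d1 d3; clear; lia.
have xor : (3 %| be)%Z = ~~ (3 %| de)%Z.
  case: (boolP (3 %| be)%Z) => hb; case: (boolP (3 %| de)%Z) => hd //.
    move: sq; rewrite -(@dvdz_prime_exp 3 be 1) // in hb.
    rewrite -(@dvdz_prime_exp 3 de 1) // in hd; move: hb hd; clear.
    by move: (be ^+ 2) (de ^+ 2) => x y; lia.
  move: sq (sqr_mod3 hb) (sqr_mod3 hd); clear.
  by move: (be ^+ 2) (de ^+ 2) => x y; lia.
exists 1; split=> //; rewrite ?mul1r.
  by move: xor; clear; lia.
have -> : be + d * de = be - de + (d + 1) * de by ring.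
have : (3 %| (d + 1) * de)%Z by apply: dvdz_mulr; move: d1 d3; clear; lia.
by move: xor; clear; move: ((d + 1) * de) => x; lia.
Qed.

Hypothesis Q0 : Q != 0.
Definition admissible v :=
  [/\ primvec v, ~~ (3 %| qform v)%Z & coprimez (qform v) Q].

Lemma vcong_mod3_generic v w w' s : ~~ (3 %| s)%Z ->
  vcong 81 (s * w.1, s * w.2) w' -> mod3_generic v w' -> mod3_generic v w.
Proof.
move=> s3 /andP[/= /dvdzP[k Ek] /dvdzP[l El]] /andP[h1 h2]; apply/andP; split.
  apply: contra h1 => h; have -> : det2 v w' = s * det2 v w - 3 * (27 * (v.1 * l - v.2 * k)).
    rewrite /det2; have -> : w'.1 = s * w.1 - k * 81 by rewrite -Ek; ring.
    by have -> : w'.2 = s * w.2 - l * 81 by [rewrite -El; ring]; ring.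
  by apply: rpredB; [exact: dvdz_mull | exact: dvdz_mulr].
apply: contra h2 => h; have -> : bform v w' = s * bform v w
     - 3 * (27 * (a * v.1 * k + b * (v.1 * l + v.2 * k) + c * v.2 * l)).
  rewrite /bform; have -> : w'.1 = s * w.1 - k * 81 by rewrite -Ek; ring.
  by have -> : w'.2 = s * w.2 - l * 81 by [rewrite -El; ring]; ring.
by apply: rpredB; [exact: dvdz_mull | exact: dvdz_mulr].
Qed.

Lemma qform_unit_mod3_neq0 w : ~~ (3 %| qform w)%Z ->
  ~~ (3 %| w.1)%Z || ~~ (3 %| w.2)%Z.
Proof.
apply: contraR; rewrite negb_or !negbK => /andP[/dvdzP[k Ek] /dvdzP[l El]].
rewrite /qform Ek El; apply/dvdzP.
by exists (3 * (a * k ^+ 2 + 2 * b * k * l + c * l ^+ 2)); ring.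
Qed.
Lemma admissible_direction w0 (N : int) : N != 0 -> ~~ (3 %| qform w0)%Z ->
  exists w, [/\ admissible w, coprimez N (qform w) &
    forall v, mod3_generic v w0 -> mod3_generic v w].
Proof.
move=> N0 q3.
have [|w [s [pw s3 ws hw]]] := @primvec_avoiding w0 (N * Q) _ (qform_unit_mod3_neq0 q3).
  by rewrite mulf_neq0.
have qw3 : ~~ (3 %| qform w)%Z.
  have : ~~ (3 %| qform (s * w.1, s * w.2))%Z by apply: vcong_ndvd ws _ q3.
  by rewrite qform_scale; apply: contra; apply: dvdz_mull.
have co M : (M %| N * Q)%Z -> coprimez M (qform w).
  move=> hM; apply: coprimez_primes => l l_pr lM.
  have [->//|l3] := eqVneq l 3%N; apply: hw => //; exact: dvdz_trans lM hM.
exists w; split=> //; last by move=> v; apply: vcong_mod3_generic ws.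
  by split=> //; rewrite coprimez_sym co // dvdz_mull.
by rewrite co // dvdz_mulr.
Qed.

Lemma trivial_symbol_generic v w : admissible v -> admissible w ->
  coprimez (qform v) (qform w) -> mod3_generic v w ->
  trivial_symbol v (qform v) -> trivial_symbol w (qform w).
Proof.
move=> [pv v3 vQ] [pw w3 wQ] co /andP[r3 u3].
by apply: (@trivial_symbol_step v w _ _ 0 0); rewrite ?expr0 ?mul1r.
Qed.

Lemma mod3_genericC v w : mod3_generic v w = mod3_generic w v.
Proof. by rewrite /mod3_generic det2C bformC rpredN. Qed.

Lemma qform_neq0 v : ~~ (3 %| qform v)%Z -> qform v != 0.
Proof. by apply: contraNneq => ->. Qed.

Lemma trivial_symbol_two_steps v0 v1 : ~~ (3 %| D - 1)%Z ->
  admissible v0 -> admissible v1 ->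
  (3 %| D)%Z \/ (3 %| qform v0 - qform v1)%Z ->
  trivial_symbol v0 (qform v0) -> trivial_symbol v1 (qform v1).
Proof.
move=> D1 A0 A1 hD; have [_ q0 _] := A0; have [_ q1 _] := A1.
have [w0 [qw0 g0 g1]] := direction_mod3 D1 q0 q1 hD.
have [|w [Aw cw hw]] := @admissible_direction w0 (qform v0 * qform v1) _ qw0.
  by rewrite mulf_neq0 ?qform_neq0.
have /andP[c0 c1] : coprimez (qform v0) (qform w) && coprimez (qform v1) (qform w).
  by rewrite -coprimezMl.
move/(trivial_symbol_generic A0 Aw c0 (hw _ g0)).
apply: trivial_symbol_generic => //; first by rewrite coprimez_sym.
by rewrite mod3_genericC hw.
Qed.

(** If [D = 1] modulo 3, two vectors with values prime to 3 are
    parallel or orthogonal modulo 3, and never in general position. An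
    isotropic direction is in general position with both of them. It is
    realized by a vector of value [27 * m] with [m] prime to 3, and the cube 27
    disappears from the symbols. *)
Lemma trivial_symbol_isotropic v0 v1 : (3 %| D - 1)%Z -> ~~ (3 %| a)%Z ->
  admissible v0 -> admissible v1 ->
  trivial_symbol v0 (qform v0) -> trivial_symbol v1 (qform v1).
Proof.
move=> D1 a3 A0 A1; have [p0 q0 cQ0] := A0; have [p1 q1 cQ1] := A1.
have [s0 Es0] : exists s, (81 %| s ^+ 2 - (D + 27))%Z.
  have : (3 %| D + 27 - 1)%Z by move: D1; clear; move: D => x; lia.
  (* Units that are 1 modulo 3 form a group of order 27 modulo 81: x ^ 28 = x. *)
  move: (D + 27) => x /dvdzP[k Ek]; have Ex : x = 1 + 3 * k by rewrite [3 * k]mulrC -Ek; ring.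
  exists (x ^+ 14).
  have h9 : exists k2, x ^+ 3 = 1 + 9 * k2.
    by exists (k + 3 * k ^+ 2 + 3 * k ^+ 3); rewrite Ex; ring.
  have h27 : exists k3, x ^+ 9 = 1 + 27 * k3.
    have [k2 E2] := h9; exists (k2 + 9 * k2 ^+ 2 + 27 * k2 ^+ 3).
    by rewrite -[9%N]/(3 * 3)%N exprM E2; ring.
  have [k3 E3] := h27; apply/dvdzP; exists (x * (k3 + 27 * k3 ^+ 2 + 243 * k3 ^+ 3)).
  have -> : (x ^+ 14) ^+ 2 = x * (x ^+ 9) ^+ 3 by ring.
  by rewrite E3; ring.
have [a' Ea'] : exists a', (81 %| a * a' - 1)%Z.
  have : coprimez a 81.
    by rewrite -[81]/(3 ^+ 4 : int) coprimezXr // coprimez3.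
  case/coprimezP => -[u v] /= E; exists u; apply/dvdzP; exists (- v).
  by rewrite -[X in _ - X = _]E; ring.
(* Completing the square: a f(w0) = s0 ^ 2 - D, which is 27 modulo 81. *)
pose w0 := (a' * (s0 - b), 1 : int).
have Ew0 : (81 %| a * qform w0 - 27)%Z.
  have [k Ek] := dvdzP Ea'; have [l El] := dvdzP Es0.
  have Es : s0 ^+ 2 = l * 81 + (D + 27) by rewrite -El subrK.
  apply/dvdzP; exists (l + k * (s0 - b) * (k * 81 * (s0 - b) + 2 * s0)).
  have -> : a * qform w0 - 27 = (a * a' * (s0 - b) + b) ^+ 2 - (D + 27).
    by rewrite /qform /w0 /=; ring.
  have -> : a * a' = k * 81 + 1 by rewrite -Ek subrK.
  have -> : ((k * 81 + 1) * (s0 - b) + b) ^+ 2 =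
    81 * (k * (s0 - b) * (k * 81 * (s0 - b) + 2 * s0)) + s0 ^+ 2 by ring.
  by rewrite Es; ring.
have qv0 : qform v0 * qform v1 * Q != 0 by rewrite !mulf_neq0 ?qform_neq0.
have [|w [s [pw s3 ws hw]]] := @primvec_avoiding w0 _ qv0; first by rewrite orbT.
have [m [Em m3]] : exists m, qform w = 27 ^+ 1 * m /\ ~~ (3 %| m)%Z.
  have : (81 %| a * s ^+ 2 * qform w - 27)%Z.
    have := qform_cong ws; rewrite qform_scale => h.
    have -> : a * s ^+ 2 * qform w - 27 =
      a * (s ^+ 2 * qform w - qform w0) + (a * qform w0 - 27) by ring.
    by rewrite rpredD // dvdz_mull.
  case/dvdzP=> k Ek.
  have co : coprimez 27 (a * s ^+ 2).
    rewrite coprimez_sym -[27]/(3 ^+ 3 : int) coprimezXr // coprimezMl coprimez3 //=.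
    by rewrite coprimez_sym coprimezXr // coprimez_sym coprimez3.
  have : (27 %| qform w)%Z.
    rewrite -(Gauss_dvdzr _ co); apply/dvdzP; exists (3 * k + 1).
    by rewrite -[LHS](subrK 27) Ek; ring.
  case/dvdzP=> m Em; exists m; split; first by rewrite Em; ring.
  have E1 : a * s ^+ 2 * m = 3 * k + 1.
    apply: (@mulfI _ (27 : int)) => //.
    have -> : 27 * (3 * k + 1) = k * 81 + 27 by ring.
    by rewrite -Ek Em; ring.
  apply/negP => /(dvdz_mull (a * s ^+ 2)); rewrite E1; clear; lia.
have cN (M : int) : (M %| qform v0 * qform v1 * Q)%Z -> coprimez M m.
  move=> hM; apply: coprimez_primes => l l_pr lM.
  have [->//|l3] := eqVneq l 3%N.
  have : ~~ (l %| qform w)%Z by apply: hw => //; apply: dvdz_trans lM hM.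
  by apply: contra => h; rewrite Em dvdz_mull.
have c0 : coprimez (qform v0) m by apply: cN; rewrite -mulrA dvdz_mulr.
have c1 : coprimez (qform v1) m by apply: cN; rewrite mulrAC dvdz_mull.
have cQ : coprimez m Q by rewrite coprimez_sym; apply: cN; rewrite dvdz_mull.
have gen v : primvec v -> ~~ (3 %| qform v)%Z -> mod3_generic v w.
  move=> pv qv; have qw : (3 %| qform w)%Z by rewrite Em; apply: dvdz_mulr.
  have r3 : ~~ (3 %| det2 v w)%Z.
    have [k [x Ek]] := qform_primvec v pw; apply: contra qv => h.
    by rewrite Ek; apply: rpredD; [exact: dvdz_mull | apply: dvdz_mulr; rewrite det2C rpredN].
  rewrite /mod3_generic r3 /=; have := qformM v w; have := sqr_mod3 r3.
  have <- : (3 %| bform v w ^+ 2)%Z = (3 %| bform v w)%Z by exact: dvdz_prime_exp.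
  have : (3 %| qform v * qform w)%Z by apply: dvdz_mull.
  move: D1 (qform v * qform w) => /dvdzP[k Ek] x.
  have -> : D = 1 + 3 * k by rewrite [3 * k]mulrC -Ek; ring.
  rewrite mulrDl mul1r -mulrA.
  move: (det2 v w ^+ 2) (bform v w ^+ 2) => C B.
  by move: (k * C) => A; clear; lia.
have step0 : trivial_symbol v0 (qform v0) -> trivial_symbol w m.
  have /andP[r3 u3] := gen _ p0 q0.
  by apply: (@trivial_symbol_step v0 w _ _ 0 1); rewrite ?expr0 ?mul1r.
have step1 : trivial_symbol w m -> trivial_symbol v1 (qform v1).
  have := gen _ p1 q1; rewrite mod3_genericC => /andP[r3 u3].
  by apply: (@trivial_symbol_step w v1 _ _ 1 0); rewrite ?expr0 ?mul1r // coprimez_sym.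
by move/step0/step1.
Qed.

(** When [D] is 2 modulo 3 and the two values differ modulo 3, an extra first
    step reaches a vector whose value agrees with that at [v1]. *)
Lemma trivial_symbol_invariant v0 v1 : ~~ (3 %| a)%Z ->
  admissible v0 -> admissible v1 ->
  trivial_symbol v0 (qform v0) -> trivial_symbol v1 (qform v1).
Proof.
move=> a3 A0 A1 h0; have [D1|D1] := boolP (3 %| D - 1)%Z.
  exact: trivial_symbol_isotropic h0.
have [D0|D0] := boolP (3 %| D)%Z.
  by apply: (trivial_symbol_two_steps D1 A0 A1) h0; left.
have [E|E] := boolP (3 %| qform v0 - qform v1)%Z.
  by apply: (trivial_symbol_two_steps D1 A0 A1) h0; right.
have [_ q0 _] := A0; have [_ q1 _] := A1.
have [|w0 [qw0 g0 _]] := direction_mod3 D1 q0 q0; first by right; rewrite subrr.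
have [w [Aw cw hw]] := admissible_direction (qform_neq0 q0) qw0.
have hw1 := trivial_symbol_generic A0 Aw cw (hw _ g0) h0.
apply: (trivial_symbol_two_steps D1 Aw A1) hw1; right.
have /andP[r3 u3] := hw _ g0; have := qformM v0 w.
have := sqr_mod3 r3; have := sqr_mod3 u3; have [_ qw _] := Aw.
move: D1 D0; move: D => d d1 d0.
have /dvdzP[k Ek] : (3 %| d + 1)%Z by move: d1 d0; clear; lia.
have -> : d = 3 * k - 1 by rewrite [3 * k]mulrC -Ek; ring.
rewrite mulrBl mul1r -mulrA; move: (det2 v0 w ^+ 2) (bform v0 w ^+ 2) => C B.
move: (k * C) => A.
move: E q0 q1 qw; move: (qform v0) (qform v1) (qform w) => x y z; clear.
move=> E x3 y3 z3 B3 C3 M.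
have : (3 %| x * z + 1)%Z by move: B3 C3 M; move: (x * z) => xz; clear; lia.
move: E x3 y3 z3; clear => E x3 y3 z3.
have : (3 %| x - 1)%Z || (3 %| x + 1)%Z by move: x3; clear; lia.
case/orP=> /dvdzP[i Ei].
  have -> : x = 1 + 3 * i by rewrite [3 * i]mulrC -Ei; ring.
  by rewrite mulrDl mul1r -mulrA; move: (i * z) => iz; lia.
have -> : x = 3 * i - 1 by rewrite [3 * i]mulrC -Ei; ring.
by rewrite mulrBl mul1r -mulrA; move: (i * z) => iz; lia.
Qed.

End Form.

(** * The symbol over a split prime *)

Lemma intr_Fp_eq0 p (n : int) : prime p -> (n%:~R == 0 :> 'F_p) = (p %| n)%Z.
Proof.
move=> p_pr; have pF := pchar_Fp p_pr; rewrite dvdzE absz_nat.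
case: n => n; first by rewrite -pmulrn -(dvdn_pcharf pF).
by rewrite NegzE mulrNz oppr_eq0 -pmulrn -(dvdn_pcharf pF) abszN.
Qed.

Lemma eis_dvd_int_eom (m : int) (z : eisenstein) : eis_dvd m%:~R z -> (m %| eom z)%Z.
Proof.
by case=> k ->; apply/dvdzP; exists (eom k); rewrite !eisE; ring.
Qed.

(** A prime above [p] which is not of norm [p] is a rational integer [m]. The
    prime [p] divides the norm of [omega - w], where [w] is a primitive cube
    root of unity modulo [p]. So [m] would divide this element or its
    conjugate, in which [omega] has coefficient 1 or -1. *)
Lemma split_prime p : prime p -> (p %% 3)%N = 1%N ->
  exists pi, [/\ eis_prime pi, eis_primary pi & eis_norm pi = p].
Proof.
move=> p_pr p1; have p3 : ~~ (3 %| p%:Z)%Z by move: p1; lia.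
have [s hs] := primary_factorization_exists (primary_up_to_sign_int p3).
have [pi pis] : exists pi, pi \in s.
  case: s hs => [[_ []]|pi s _]; last by exists pi; rewrite mem_head.
    by rewrite big_nil => /(congr1 ere); rewrite ere_int /=; have := prime_gt1 p_pr; lia.
  by rewrite big_nil => /(congr1 ere); rewrite ere_int /=; have := prime_gt1 p_pr; lia.
have [Pp Qp] := proj1 hs pi pis; have pip := primary_factorization_dvd hs pis.
have [p0 pn1 pP] := Pp.
have [q [k [q_pr q3 piq Nq kN]]] := primary_prime_classify Pp Qp.
exists pi; split=> //; case: kN => [k1|[m Em]].
  have := eis_dvd_norm pip; rewrite Nq k1 expn1 eis_norm_int dvdzE abszX !absz_nat.
  by rewrite Euclid_dvdX // andbT dvdn_prime2 // => /eqP ->.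
have [|w Ew] := @finField_cube_root 'F_p.
  by rewrite card_Fp //; have := prime_gt1 p_pr; move: p1; lia.
have pd : eis_dvd pi ((omega - (w : nat)%:R) * eis_conj (omega - (w : nat)%:R)).
  apply: eis_dvd_trans pip _; rewrite -eis_normE; apply: eis_dvd_int.
  rewrite -intr_Fp_eq0 //.
  have -> : eis_norm (omega - (w : nat)%:R) = (w : nat)%:Z ^+ 2 + (w : nat)%:Z + 1.
    by rewrite /eis_norm !eisE /=; ring.
  rewrite !intrD rmorphXn /= -!pmulrn !natr_FpK.
  by rewrite Ew.
case: pn1; apply/eis_dvd1; rewrite Em eis_norm_int.
have : (m %| 1)%Z.
  by case: (pP _ _ pd); rewrite Em => /eis_dvd_int_eom;
    rewrite ?eom_conj eomD eomN eom_nat subr0 ?rpredN.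
by rewrite dvdz1; move: m {Em} => [[|[|m]]|[|m]].
Qed.

Section ResidueSymbol.
Variables (p : nat) (pi : eisenstein).
Hypotheses (p_pr : prime p) (Pp : eis_prime pi) (Qp : eis_primary pi).
Hypothesis Np : eis_norm pi = p.

Lemma eis_dvd_prime_int (n : int) : eis_dvd pi n%:~R <-> (p %| n)%Z.
Proof.
split=> [/eis_dvd_norm|h].
  by rewrite Np eis_norm_int !dvdzE abszX Euclid_dvdX // andbT.
apply: eis_dvd_trans (eis_dvd_self_norm pi) _; rewrite Np; exact: eis_dvd_int.
Qed.

(** The nonzero residues modulo [p] are powers of a primitive root, and the
    symbol is 1 when the exponent is a multiple of 3. *)
Lemma cubic_residue_symbol (n : int) : ~~ (p %| n)%Z ->
  cubic_residue n p <-> cubic_symbol n%:~R pi = 1.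
Proof.
move=> pn; split=> [[x /eqP]|].
  rewrite eqz_mod_dvd => h.
  have px : ~~ (p %| x)%Z.
    apply: contra pn => px; rewrite -[n](subrK (x ^+ 3)) rpredD //.
    by rewrite exprS dvdz_mulr.
  rewrite (@cubic_symbol_congr _ (x ^+ 3)%:~R) //; last first.
    by rewrite -intrB; apply/eis_dvd_prime_int.
  have [xv _] := cubic_symbolP x%:~R Pp Qp.
  have x0 : cubic_symbol x%:~R pi != 0.
    by apply/eqP => /(cubic_symbol_eq0 _ Pp Qp) /eis_dvd_prime_int; apply/negP.
  transitivity (cubic_symbol x%:~R pi ^+ 3); last exact: cubic_values_cube.
  by rewrite !exprS expr0 !mulr1 !intrM !cubic_symbolM.
have [rho rho0] := eis_rmorph_Fp Qp p_pr Np.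
move=> s1; have [_] := cubic_symbolP n%:~R Pp Qp; rewrite s1.
move/(eis_rmorph_ker _ Pp rho0)/eqP.
rewrite rmorphB rmorph1 rmorphXn rmorph_int subr_eq0 /cubic_exponent Np absz_nat => /eqP E.
have [|g gP] := @finField_primitive_root 'F_p p.-1; first by rewrite card_Fp.
have t0 : n%:~R != 0 :> 'F_p by rewrite intr_Fp_eq0.
have p1 : (0 < p.-1)%N by have := prime_gt1 p_pr; lia.
have [|i Ei] := prim_rootP gP (x := n%:~R).
  apply: (mulfI t0); rewrite mulr1 -exprS prednK ?prime_gt0 //.
  by have := expf_card (n%:~R : 'F_p); rewrite card_Fp.
have p3 := primary_prime_norm_mod3 Qp p_pr Np.
have Ep : p.-1 = (p.-1 %/ 3 * 3)%N by have := prime_gt0 p_pr; move: p3; lia.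
have e0 : (0 < p.-1 %/ 3)%N by move: Ep p1; lia.
have i3 : (3 %| i)%N.
  rewrite -(dvdn_pmul2l e0) -Ep (prim_order_dvd gP) mulnC exprM -Ei E; exact: eqxx.
exists ((g ^+ (i %/ 3) : 'F_p) : nat); apply/eqP; rewrite eqz_mod_dvd -intr_Fp_eq0 //.
rewrite intrB rmorphXn /= -pmulrn natr_FpK -exprM divnK // Ei subrr; exact: eqxx.
Qed.

(** The two primes above [p] are conjugate, and conjugating a cube root of
    unity amounts to squaring it. *)
Lemma cubic_jacobi_split_prime (alpha : eisenstein) :
  cubic_jacobi alpha p%:~R = cubic_symbol (alpha * eis_conj alpha ^+ 2) pi.
Proof.
have Ps := eis_conj_prime Pp; have Qs := eis_conj_primary Qp.
rewrite (@cubic_jacobiE _ _ [:: pi; eis_conj pi]); last first.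
  split=> [x|]; first by rewrite !inE => /orP[]/eqP->.
  by left; rewrite big_cons big_seq1 -eis_normE Np.
rewrite big_cons big_seq1 -{2}[alpha]eis_conjK cubic_symbol_conj // expr2 !cubic_symbolM //.
congr (_ * _); have [h _] := cubic_symbolP (eis_conj alpha) Pp Qp.
by move: h; rewrite !inE => /or4P[] /eqP->; apply/eqP.
Qed.

(** Modulo [pi] the norm of [gam P r u] is [r ^+ 2 * Q] and its conjugate is
    [r * (P + t)] or [r * (P - t)], as [3 * u * theta] is a square root of
    [(r * t) ^+ 2]. The sign does not matter: the product of [Q * (P + t)] and
    [Q * (P - t)] is the cube of [Q] modulo [p]. *)
Lemma cubic_jacobi_gam_residue (P D Q r u t : int) : Q = P ^+ 2 + 27 * D ->
  ~~ (p %| Q)%Z -> (t ^+ 2 = P ^+ 2 - Q %[mod p])%Z ->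
  ~~ (p %| r)%Z -> (p %| u ^+ 2 - D * r ^+ 2)%Z ->
  cubic_jacobi (gam P r u) p%:~R = 1 <-> cubic_residue (Q * (P + t)) p.
Proof.
move=> EQ pQ /eqP; rewrite eqz_mod_dvd => ht pr hu.
have sM (x y : int) : cubic_symbol (x * y)%:~R pi =
    cubic_symbol x%:~R pi * cubic_symbol y%:~R pi.
  by rewrite intrM cubic_symbolM.
have sC (x y : int) : (p %| x - y)%Z ->
    cubic_symbol x%:~R pi = cubic_symbol y%:~R pi.
  by move=> h; apply: cubic_symbol_congr => //; rewrite -intrB; apply/eis_dvd_prime_int.
have s3 (x : int) : ~~ (p %| x)%Z -> cubic_symbol (x ^+ 3)%:~R pi = 1.
  by move=> px; apply/cubic_residue_symbol; [rewrite dvdz_prime_exp | exists x].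
have pt e : e ^+ 2 = 1 -> ~~ (p %| Q * (P + e * t))%Z.
  move=> e1; rewrite dvdz_prime_mul // negb_or pQ /=; apply: contra pQ => h.
  have -> : Q = (P + e * t) * (P - e * t) + (t ^+ 2 - (P ^+ 2 - Q)).
    have -> : (P + e * t) * (P - e * t) = P ^+ 2 - e ^+ 2 * t ^+ 2 by ring.
    by rewrite e1; ring.
  by rewrite rpredD // dvdz_mulr.
have main e : e ^+ 2 = 1 -> eis_dvd pi ((3 * u)%:~R * theta - (e * r * t)%:~R) ->
    cubic_jacobi (gam P r u) p%:~R = cubic_symbol (Q * (P + e * t))%:~R pi.
  move=> e1 he; rewrite cubic_jacobi_split_prime.
  transitivity (cubic_symbol (r ^+ 3 * (Q * (P + e * t)))%:~R pi); last first.
    by rewrite sM s3 // mul1r.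
  apply: cubic_symbol_congr => //; set g := gam P r u.
  have -> : g * eis_conj g ^+ 2 = (eis_norm g)%:~R * eis_conj g by rewrite eis_normE; ring.
  have Eg : eis_conj g = (r * (P + e * t))%:~R + ((3 * u)%:~R * theta - (e * r * t)%:~R).
    by apply: eisP; rewrite ?ere_conj ?eom_conj ?ere_gam ?eom_gam /theta !eisE /=; ring.
  have dN : eis_dvd pi ((eis_norm g)%:~R - (r ^+ 2 * Q)%:~R).
    rewrite -intrB; apply/eis_dvd_prime_int; rewrite gam_norm EQ.
    have -> : r ^+ 2 * P ^+ 2 + 27 * u ^+ 2 - r ^+ 2 * (P ^+ 2 + 27 * D) =
       27 * (u ^+ 2 - D * r ^+ 2) by ring.
    exact: dvdz_mull.
  have -> : (r ^+ 3 * (Q * (P + e * t)))%:~R =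
      (r ^+ 2 * Q)%:~R * (r * (P + e * t))%:~R :> eisenstein.
    by rewrite -intrM; congr (_%:~R); ring.
  rewrite Eg; move: dN he; set A := (eis_norm g)%:~R; set B := (r ^+ 2 * Q)%:~R.
  set X := (r * _)%:~R; set Y := (3 * u)%:~R * theta - (e * r * t)%:~R => dN he.
  have -> : A * (X + Y) - B * X = X * (A - B) + A * Y by ring.
  by apply: eis_dvdD; apply: eis_dvd_mull.
have conjP : cubic_symbol (Q * (P + -1 * t))%:~R pi = 1 <->
    cubic_symbol (Q * (P + t))%:~R pi = 1.
  have E : cubic_symbol (Q * (P + -1 * t))%:~R pi *
      cubic_symbol (Q * (P + t))%:~R pi = 1.
    rewrite -sM; transitivity (cubic_symbol (Q ^+ 3)%:~R pi); last exact: s3.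
    apply: sC.
    have -> : Q * (P + -1 * t) * (Q * (P + t)) - Q ^+ 3 =
      - (Q ^+ 2 * (t ^+ 2 - (P ^+ 2 - Q))) by ring.
    by rewrite rpredN dvdz_mull.
  by split=> h; move: E; rewrite h ?mul1r ?mulr1.
have [e [e1 he]] : exists e, e ^+ 2 = 1 /\
    eis_dvd pi ((3 * u)%:~R * theta - (e * r * t)%:~R).
  have : eis_dvd pi (((3 * u)%:~R * theta - (1 * r * t)%:~R) *
      ((3 * u)%:~R * theta - (-1 * r * t)%:~R)).
    have -> : ((3 * u)%:~R * theta - (1 * r * t)%:~R) *
      ((3 * u)%:~R * theta - (-1 * r * t)%:~R) =
      (- (27 * (u ^+ 2 - D * r ^+ 2)) - r ^+ 2 * (t ^+ 2 - (P ^+ 2 - Q)))%:~R.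
      by rewrite EQ; apply: eisP; rewrite /theta !eisE /=; ring.
    apply/eis_dvd_prime_int.
    by apply: rpredB; [rewrite rpredN; apply: dvdz_mull | apply: dvdz_mull].
  by have [_ _ pP] := Pp; case/pP => h; [exists 1 | exists (-1)].
have e_pm : e = 1 \/ e = -1.
  by move/eqP: e1; rewrite sqrf_eq1 => /orP[]/eqP; [left | right].
have pQt : ~~ (p %| Q * (P + t))%Z by have := pt 1 (expr1n _ _); rewrite mul1r.
rewrite (main e e1 he) (cubic_residue_symbol pQt).
by case: e_pm => ->; rewrite ?mul1r.
Qed.

End ResidueSymbol.

(** * Form classes *)

Lemma bqf_eval_qform a b c x y :
  bqf_eval (BQF a (2 * b) c) x y = qform a b c (x, y).
Proof. by []. Qed.

Lemma bqf_equiv_refl f : bqf_equiv f f.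
Proof.
exists 1, 0, 0, 1; split=> // x y.
by rewrite !mul1r !mul0r addr0 add0r.
Qed.

Lemma bqf_coefA f : bqfA f = bqf_eval f 1 0.
Proof. by rewrite /bqf_eval; ring. Qed.
Lemma bqf_coefC f : bqfC f = bqf_eval f 0 1.
Proof. by rewrite /bqf_eval; ring. Qed.
Lemma bqf_coefB f : bqfB f = bqf_eval f 1 1 - bqf_eval f 1 0 - bqf_eval f 0 1.
Proof. by rewrite /bqf_eval; ring. Qed.

Lemma bqf_equiv_disc f g : bqf_equiv f g -> bqf_disc g = bqf_disc f.
Proof.
move=> [p [q [r [s [E h]]]]]; rewrite -[RHS]mulr1 -(expr1n _ 2) -{1}E.
rewrite /bqf_disc (bqf_coefA g) (bqf_coefB g) (bqf_coefC g) !h /bqf_eval.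
ring.
Qed.

(** The discriminant and the set of values are invariants of the class. *)
Lemma form_class_values a b c D : form_classes (4 * D) (bqf_class (BQF a (2 * b) c)) ->
  D = b ^+ 2 - a * c /\
  forall l : nat, prime l -> exists v, ~~ (l %| qform a b c v)%Z.
Proof.
move=> [f [Ef fprim fdisc _]].
have [p [q [r [s [E h]]]]] : bqf_equiv (BQF a (2 * b) c) f.
  have : bqf_class f f by apply: bqf_equiv_refl.
  by rewrite -Ef.
split.
  have : bqf_disc f = bqf_disc (BQF a (2 * b) c).
    by apply: bqf_equiv_disc; exists p, q, r, s.
  rewrite fdisc /bqf_disc /= => Ed; apply: (@mulfI _ (4 : int)) => //.
  by rewrite Ed; ring.
move=> l l_pr; apply: contrapT => no.
have dv x y : (l %| bqf_eval f x y)%Z.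
  rewrite h bqf_eval_qform; apply: contraT => hn; case: no.
  by exists (p * x + q * y, r * x + s * y).
have : (l %| gcdz (gcdz (bqfA f) (bqfB f)) (bqfC f))%Z.
  by rewrite !dvdz_gcd bqf_coefA bqf_coefB bqf_coefC !dv !rpredB.
by rewrite fprim dvdz1 absz_nat gtn_eqF ?prime_gt1.
Qed.

(** The square of the content of [v] divides the value at [v]. *)
Lemma primvec_prime_value a b c v p : prime p -> qform a b c v = p -> primvec v.
Proof.
move=> p_pr Ev; have [|d [w [pw E d0]]] := @primvec_scale v.
  apply: contra_eq_neq Ev => ->; rewrite /qform /=.
  by have := prime_gt0 p_pr; lia.
have : (`|d| ^ 2 %| p)%N.
  rewrite -abszX -[X in (_ %| X)%N]/`|p%:Z|%N -Ev E qform_scale abszM.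
  exact: dvdn_mulr.
move=> d2p; have d1 : `|d|%N = 1%N.
  have := dvdn_trans (dvdn_exp (isT : (0 < 2)%N) (dvdnn `|d|%N)) d2p.
  case/(proj2 (primeP p_pr))/orP => /eqP // dp; move: d2p; rewrite dp.
  move/(dvdn_leq (prime_gt0 p_pr)); have := prime_gt1 p_pr.
  by rewrite -mulnn; clear; nia.
by rewrite /primvec E coprimezE !abszM d1 !mul1n -coprimezE.
Qed.

(** Both -3 and [- 27 * D] are squares modulo [p]. *)
Lemma sqrt_mod_prime p (D t : int) : prime p -> (p %% 3)%N = 1%N ->
  (p %| t ^+ 2 + 27 * D)%Z -> exists b : int, (p %| b ^+ 2 - D)%Z.
Proof.
move=> p_pr p1 h; have [|w Ew] := @finField_cube_root 'F_p.
  by rewrite card_Fp //; have := prime_gt0 p_pr; move: p1; lia.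
pose th : 'F_p := w + w + 1.
have th2 : th ^+ 2 = - 3.
  by apply/eqP; rewrite -subr_eq0 -[0](mulr0 4) -Ew /th; apply/eqP; ring.
have n3 : 3 != 0 :> 'F_p.
  rewrite -(dvdn_pcharf (pchar_Fp p_pr)) dvdn_prime2 //.
  by apply/eqP => E; move: p1; rewrite E.
have th0 : th != 0 by rewrite -sqrf_eq0 th2 oppr_eq0.
have : t%:~R ^+ 2 = - 27 * D%:~R :> 'F_p.
  move: h; rewrite -intr_Fp_eq0 // intrD intrM rmorphXn /= addr_eq0 => /eqP ->.
  by rewrite mulNr.
move=> Et; have [B EB] : exists B : 'F_p, B ^+ 2 = D%:~R.
  exists (t%:~R / (3 * th)); rewrite expr_div_n Et exprMn th2.
  field; have -> : - 27 = - (3 ^+ 3) :> 'F_p by ring.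
  by rewrite oppr_eq0 expf_neq0.

exists (B : nat); rewrite -intr_Fp_eq0 // intrB rmorphXn /= -pmulrn natr_FpK EB.
by rewrite subrr.
Qed.

Theorem theorem5p1 (P D Q : int)
    (hP : ~~ (3 %| P)%Z \/ (27 %| P)%Z)
    (hD : ~ exists n : int, D = n ^+ 2)
    (hQ : Q = P ^+ 2 + 27 * D)
    (hq : exists (q1 : nat) (q0 : int), (q1 <= 2)%N /\ Q = 2 ^+ q1 * q0 ^+ 3)
    (p : nat) (hp : prime p) (hp3 : (p %% 3)%N = 1%N)
    (hpQ : ~~ (p %| Q)%Z)
    (hleg : legendre (P ^+ 2 - Q) p = 1)
    (t : int) (ht : (t ^+ 2 = P ^+ 2 - Q %[mod p])%Z) :
  cubic_residue (Q * (P + t)) p <->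
  exists2 K : set bqf, classesG P D K & class_represents K p.
Proof.
have [pi [Pp Qp Np]] := split_prime hp hp3.
have p3 : ~~ (3 %| p%:Z)%Z by move: hp3; clear; lia.
have pQ : coprimez p Q by rewrite coprimezE prime_coprime // -dvdzE.
have Q0 : Q != 0 by apply: contraNneq hpQ => ->.
have pD : ~~ (p %| D)%Z.
  move: hleg; rewrite /legendre; case: ifP => // /negbT h _.
  apply: contra h => h; rewrite hQ; have -> : P ^+ 2 - (P ^+ 2 + 27 * D) = - 27 * D by ring.
  exact: dvdz_mull.
split; last first.
  case=> K [HK [a [b [c [EK ga sa _]]]]] [f Kf [x [y Efxy]]].
  rewrite EK in HK Kf; have [ED hprim] := form_class_values HK.
  case: Kf => [p' [q' [r' [s' [_ hv]]]]].
  pose v := (p' * x + q' * y, r' * x + s' * y).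
  have Ev : qform a b c v = p by rewrite Efxy hv.
  rewrite -hQ in ga.
  have co : coprimez a (3 * D * Q) by rewrite /coprimez ga.
  have a3 : ~~ (3 %| a)%Z.
    apply/negP => h; have : (3 %| gcdz a (3 * D * Q))%Z.
      by rewrite dvdz_gcd h -mulrA dvdz_mulr.
    by rewrite ga.
  have caQ : coprimez a Q by apply: coprimez_dvdr co; apply: dvdz_mull.
  have E0 : qform a b c (1, 0) = a by rewrite /qform /=; ring.
  have hQ' : Q = P ^+ 2 + 27 * (b ^+ 2 - a * c) by rewrite -ED.
  have A0 : admissible a b c Q (1, 0) by split; rewrite ?E0 // /primvec coprimezE.
  have A1 : admissible a b c Q v.
    by split; rewrite ?Ev //; apply: primvec_prime_value hp Ev.
  have T0 : trivial_symbol a b c P (1, 0) (qform a b c (1, 0)).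
    rewrite E0.
    have Er : det2 (1, 0) (0, 1) = 1 by rewrite /det2 /=; ring.
    have Eu : bform a b c (1, 0) (0, 1) = b by rewrite /bform /=; ring.
    exists (0, 1); first by rewrite Er coprimezE coprime1n.
    by rewrite Er Eu /gam mul1r.
  have [z cz z1] := trivial_symbol_invariant hP hQ' hq hprim Q0 a3 A0 A1 T0.
  rewrite Ev in cz z1.
  have pdet : ~~ (p %| det2 v z)%Z.
    by move: cz; rewrite coprimez_sym coprimezE prime_coprime // -dvdzE.
  have pnorm : (p %| bform a b c v z ^+ 2 - D * det2 v z ^+ 2)%Z.
    by rewrite ED -qformM Ev; apply: dvdz_mulr.
  exact: (proj1 (cubic_jacobi_gam_residue hp Pp Qp Np hQ hpQ ht pdet pnorm) z1).
move=> res.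
have [b Eb] : exists b : int, (p %| b ^+ 2 - D)%Z.
  apply: (@sqrt_mod_prime p D t) => //.
  have -> : t ^+ 2 + 27 * D = t ^+ 2 - (P ^+ 2 - Q) by rewrite hQ; ring.
  by rewrite -eqz_mod_dvd; apply/eqP.
have [c Ec] := dvdzP Eb.
pose f := BQF p%:Z (2 * b) c.
have Ed : D = b ^+ 2 - p%:Z * c by rewrite mulrC -Ec; ring.
exists (bqf_class f); last first.
  exists f; first exact: bqf_equiv_refl.
  by exists 1, 0; rewrite /f /bqf_eval /=; ring.
have pb : ~~ (p %| b)%Z.
  apply: contra pD => h; rewrite -[D](subKr (b ^+ 2)) rpredB // expr2 dvdz_mulr //.
have p2b : coprimez p%:Z (2 * b).
  have := pb; rewrite dvdzE absz_nat => pb'.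
  rewrite coprimezE absz_nat prime_coprime // abszM Euclid_dvdM // negb_or pb' andbT.
  apply/negP => /(dvdn_leq (isT : (0 < 2)%N)); have := prime_gt1 hp.
  by move: hp3; clear; lia.
split.
  exists f; split=> //.
  - rewrite /bqf_primitive /f /=; move/eqP: p2b => ->; exact: gcd1z.
  - by rewrite /f /bqf_disc /= Ed; ring.
  move=> D0 x y xy; have p0 : 0 < p%:Z by have := prime_gt0 hp.
  have D0' : D < 0 by move: D0; clear; lia.
  rewrite -(pmulr_rgt0 _ p0) /f bqf_eval_qform.
  have -> : p%:Z * qform p b c (x, y) = (p%:Z * x + b * y) ^+ 2 + (- D) * y ^+ 2.
    by rewrite Ed /qform /=; ring.
  have [y0|y0] := eqVneq y 0.
    rewrite y0 expr0n mulr0 addr0 mulr0 addr0 exprn_even_gt0 //= mulf_neq0 //.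
      by rewrite gt_eqF.
    by apply: contraNneq xy => ->; rewrite y0.
  rewrite ltr_wpDl ?sqr_ge0 // mulr_gt0 ?oppr_gt0 //.
  by rewrite exprn_even_gt0.
exists p%:Z, b, c; split=> //.
- apply/eqP; rewrite -hQ -/(coprimez _ _) !coprimezMr coprimez3 //= pQ andbT.
  by rewrite coprimezE prime_coprime // -dvdzE.
- have h : (p %| b ^+ 2 - D * 1 ^+ 2)%Z by rewrite expr1n mulr1.
  have p1 : ~~ (p %| 1)%Z by rewrite dvdz1 absz_nat gtn_eqF ?prime_gt1.
  have /(_ P D Q t hQ hpQ ht p1 h) [_ /(_ res)] :=
    @cubic_jacobi_gam_residue p pi hp Pp Qp Np _ _ _ 1 b.
  by rewrite /gam mul1r.
- by have := prime_gt0 hp; lia.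
Qed.
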